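(* Let $n\ge1$, $k\in\{0,\dots,n\}$, and let $\mu_{k,n-k}$ be the uniform law on the slice $\mathcal X_{k,n-k}=\{x\in\{0,1\}^n:\sum_{i=1}^nx_i=k\}$ of the discrete cube. Put $C_{k,n-k}=\min(k,n-k)$. (a) For all probability measures $\nu_1$ and $\nu_2$ on $\mathcal X_{k,n-k}$, $$\frac{2}{C_{k,n-k}}W_1^2(\nu_1,\nu_2)\le\left(\sqrt{H(\nu_1|\mu_{k,n-k})}+\sqrt{H(\nu_2|\mu_{k,n-k})}\right)^2$$ and $$\frac{1}{2C_{k,n-k}}\widetilde T_2(\nu_2|\nu_1)\le\left(\sqrt{H(\nu_1|\mu_{k,n-k})}+\sqrt{H(\nu_2|\mu_{k,n-k})}\right)^2.$$ (b) For all probability measures $\nu_1$ and $\nu_2$ on $\mathcal X_{k,n-k}$, $$\frac18\,\widehat T_2(\nu_2|\nu_1)\le\left(\sqrt{H(\nu_1|\mu_{k,n-k})}+\sqrt{H(\nu_2|\mu_{k,n-k})}\right)^2.$$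
   Context: The Hamming distance on $\mathcal X_{k,n-k}$ is $d_h(x,y)=\frac12\sum_{i=1}^n\mathbf 1_{x_i\ne y_i}$. $H(\nu|\mu)=\int\log(d\nu/d\mu)\,d\nu$ if $\nu\ll\mu$ and $+\infty$ otherwise. $\Pi(\nu_1,\nu_2)$ is the set of probability measures on $\mathcal X_{k,n-k}\times\mathcal X_{k,n-k}$ with first marginal $\nu_1$ and second marginal $\nu_2$; for $\pi\in\Pi(\nu_1,\nu_2)$, $p_x$ denotes probability measures with $\pi(x,y)=\nu_1(x)p_x(y)$ for all $x,y$. Then $$W_1(\nu_1,\nu_2)=\inf_{\pi\in\Pi(\nu_1,\nu_2)}\iint d_h(x,y)\,d\pi(x,y),$$ $$\widetilde T_2(\nu_2|\nu_1)=\inf_{\pi\in\Pi(\nu_1,\nu_2)}\int\Big(\int d_h(x,y)\,dp_x(y)\Big)^2d\nu_1(x),$$ $$\widehat T_2(\nu_2|\nu_1)=\inf_{\pi\in\Pi(\nu_1,\nu_2)}\int\sum_{i=1}^n\Big(\int\mathbf 1_{x_i\ne y_i}\,dp_x(y)\Big)^2d\nu_1(x).$$ When $k\in\{0,n\}$ the slice is a single point and $C_{k,n-k}=0$; in that case the left-hand sides in (a) are read as $0$. *)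

(* Defs.v *)
From HB Require Import structures.
From mathcomp Require Import all_boot all_order all_algebra.
From mathcomp Require Import all_classical all_reals all_analysis.

Set Implicit Arguments.
Unset Strict Implicit.
Unset Printing Implicit Defensive.
Import Order.TTheory GRing.Theory Num.Theory.

Local Open Scope classical_set_scope.
Local Open Scope ring_scope.

(* All spaces involved are finite, so a probability measure is represented by
   its mass function and integrals are finite sums. *)
Definition is_prob (R : realType) (T : finType) (p : T -> R) : Prop :=
  (forall x, 0 <= p x) /\ \sum_(x : T) p x = 1.

Definition unif (R : realType) (T : finType) (x : T) : R := #|T|%:R^-1.

(* nu << mu; for nonnegative mass functions, inclusion of the null sets amounts
   to inclusion of the zero sets. *)
Definition dominated (R : realType) (T : finType) (nu mu : T -> R) : Prop :=
  forall x, mu x = 0 -> nu x = 0.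

(* When nu << mu, the density d nu / d mu at x is nu x / mu x (nu-almost
   everywhere). Since ln 0 = 0, points with nu x = 0 contribute 0. *)
Definition rel_entropy (R : realType) (T : finType) (nu mu : T -> R) : \bar R :=
  if `[< dominated nu mu >] then (\sum_(x : T) ln (nu x / mu x) * nu x)%:E
  else +oo%E.

Definition slice (n k : nat) :=
  {x : {ffun 'I_n -> bool} | (\sum_(i < n) x i == k)%N}.
HB.instance Definition _ n k := SubFinite.on (slice n k).

(* In [x / (slice_const n k)%:R] the convention [0^-1 = 0] makes the quotient 0
   when [k = 0] or [k = n]. *)
Definition slice_const (n k : nat) : nat := minn k (n - k).

Section Transport.
Variables (R : realType) (n k : nat).
Local Notation X := (slice n k).
Implicit Types (nu : X -> R) (pi : X * X -> R) (p : X -> X -> R).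

Definition differ (x y : X) (i : 'I_n) : R := (val x i != val y i)%:R.

Definition hamming (x y : X) : R := 2^-1 * \sum_(i < n) differ x y i.

Definition coupling nu1 nu2 pi : Prop :=
  [/\ is_prob pi,
      forall x, \sum_(y : X) pi (x, y) = nu1 x
    & forall y, \sum_(x : X) pi (x, y) = nu2 y].

(* The kernel p is determined by pi outside the null set [nu1 x = 0], where its
   choice does not affect the costs below. *)
Definition disintegration nu1 pi p : Prop :=
  (forall x, is_prob (p x)) /\ (forall x y, pi (x, y) = nu1 x * p x y).

Definition W1 nu1 nu2 : \bar R :=
  ereal_inf [set c | exists pi, coupling nu1 nu2 pi /\
    c = (\sum_(xy : X * X) hamming xy.1 xy.2 * pi xy)%:E].

(* T2tilde nu2 nu1 and T2hat nu2 nu1 stand for T(nu2 | nu1): the kernel goes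
   from nu1 (the second argument) to nu2. *)
Definition T2tilde nu2 nu1 : \bar R :=
  ereal_inf [set c | exists pi p,
    [/\ coupling nu1 nu2 pi, disintegration nu1 pi p &
    c = (\sum_(x : X) (\sum_(y : X) hamming x y * p x y) ^+ 2 * nu1 x)%:E]].

Definition T2hat nu2 nu1 : \bar R :=
  ereal_inf [set c | exists pi p,
    [/\ coupling nu1 nu2 pi, disintegration nu1 pi p &
    c = (\sum_(x : X)
          (\sum_(i < n) (\sum_(y : X) differ x y i * p x y) ^+ 2) * nu1 x)%:E]].

End Transport.

(* Main.v *)
Require Import Defs.
From HB Require Import structures.
From mathcomp Require Import all_boot all_order all_algebra.
From mathcomp Require Import all_classical all_reals all_analysis.
From mathcomp Require Import ring lra zify.
From mathcomp Require Import fintype finset perm.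

(* A single coupling, built by induction on k <= n / 2, serves all three costs.
   Reveal a uniformly random element i of the k-subset x; its law q1 under nu1
   is matched with the corresponding law q2 under nu2 by a maximal coupling
   (i, j), and the conditional laws of the remaining k - 1 elements, the second
   one pulled back to the complement of i by the transposition (i j), are
   coupled by induction. Entropy obeys the chain rule along this scheme.

   Elements lost by x (in x but not in y): i itself is lost only when j <> i, so
   its squared conditional probability enters once, and the other elements of x
   are handled by Jensen's inequality. This yields sum_(i in x) P_x(i lost)^2
   <= 2 * entropy, hence T2tilde by Cauchy-Schwarz, and, with Pinsker's
   inequality at each step, W1.

   Elements gained by x: the probability that l is gained accumulates over the
   steps, so the induction bounds (a_l + P_x(l gained))^2 for arbitrary offsets
   a_l >= 0. Once l has been chosen it is removed from the count, and this loss
   of potential absorbs the cross term a_l * (q2 l - q1 l). The potential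
   kappa * a_l^2 grows by a_l^2 / (number of remaining points) per step, and
   stays below 2 * a_l^2 because k <= n / 2.

   Both entropies are weighted by c1, c2 > 1 with (c1 - 1)(c2 - 1) = 1; the
   infimum of c1 * h1 + c2 * h2 is (sqrt h1 + sqrt h2)^2. For k > n / 2 the
   points of the slice are encoded by their zeros. *)

Set Implicit Arguments.
Unset Strict Implicit.
Unset Printing Implicit Defensive.
Import Order.TTheory GRing.Theory Num.Theory.
Local Open Scope ring_scope.

(** * Lower bounds for the entropy function t log t - t + 1 *)

Section EntropyFunction.
Import numFieldNormedType.Exports.
Variable R : realType.
Implicit Types a b c d s t u v : R.

Definition phi t := t * ln t - t + 1.

(** Up to an additive constant, [f] is [phi t / t] minus the partial fractions of
    [3 * (t - 1)^2 / (2 * t * (t + 2))]. Its derivative vanishes to third order at 1 and has a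
    constant sign on each side. *)
Lemma MVT_ln_rat (f := fun t : R => ln t + 4^-1 * t^-1 + 27 / 4 * (t + 2)^-1) u v :
  0 < u -> u < v ->
  exists2 c, c \in `]u, v[%R &
    f v - f u = (c - 1) ^+ 3 / (c ^+ 2 * (c + 2) ^+ 2) * (v - u).
Proof.
move=> u0 uv.
have df (x : R) : 0 < x ->
    is_derive x (1:R) f ((x - 1) ^+ 3 / (x ^+ 2 * (x + 2) ^+ 2)).
  move=> x0.
  have dinv (g : R -> R) : g x != 0 -> is_derive x 1 g 1 ->
      is_derive x 1 (fun y => (g y)^-1) (- (g x) ^- 2).
    move=> gx dg; split; first exact: derivableV.
    by rewrite deriveV// derive_val -[RHS]mulr1.
  have i1 := is_derive1_ln x0.
  have i2 : is_derive x 1 (fun y : R => y^-1) (- x ^- 2).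
    by apply: (dinv id); rewrite ?gt_eqF//; exact: is_derive_id.
  have i3 : is_derive x 1 (fun y : R => (y + 2)^-1) (- (x + 2) ^- 2).
    apply: dinv; first by rewrite gt_eqF//; lra.
    have := is_deriveD (is_derive_id x (1 : R)) (is_derive_cst (2 : R) x 1).
    by rewrite addr0.
  have := is_deriveD (is_deriveD i1 (is_deriveZ 4^-1 i2)) (is_deriveZ (27 / 4) i3) => D.
  apply: (is_derive_eq D); rewrite /GRing.scale/=.
  by field; apply/andP; split; rewrite gt_eqF//; lra.
apply: (MVT uv).
  by move=> x; rewrite in_itv/= => /andP[ux _]; apply: df; lra.
apply: derivable_within_continuous => x.
by rewrite in_itv/= => /andP[ux _]; apply: ex_derive; apply: df; lra.
Qed.

(* The difference of the two sides is a positive multiple of the function of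
   [MVT_ln_rat] minus its value at 1, whose derivative has the sign of [t - 1]. *)
Lemma phi_ge t : 0 <= t -> 3 * (t - 1) ^+ 2 <= 2 * (t + 2) * phi t.
Proof.
rewrite le_eqVlt => /predU1P[<-|t0].
  (* The convention [ln 0 = 0] gives [phi 0 = 1], and the claim reads [3 <= 4]. *)
  by rewrite /phi ln0//; lra.
suff H : 0 <= ln t + 4^-1 * t^-1 + 27 / 4 * (t + 2)^-1 - 5 / 2.
  rewrite -subr_ge0.
  have -> : 2 * (t + 2) * phi t - 3 * (t - 1) ^+ 2 =
    2 * (t * (t + 2)) * (ln t + 4^-1 * t^-1 + 27 / 4 * (t + 2)^-1 - 5 / 2).
    by rewrite /phi; field; apply/andP; split; rewrite gt_eqF//; lra.
  by rewrite mulr_ge0// ?mulr_ge0//; lra.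
have f1 : ln 1 + 4^-1 * 1^-1 + 27 / 4 * (1 + 2)^-1 = 5 / 2 :> R.
  by rewrite ln1; field.
rewrite -f1.
have den c : 0 <= c ^+ 2 * (c + 2) ^+ 2 by rewrite mulr_ge0 ?sqr_ge0.
have [t1|t1|->] := ltgtP t 1; last by rewrite subrr.
- have [c] := MVT_ln_rat t0 t1; rewrite in_itv/= => /andP[ct c1] E.
  rewrite -oppr_le0 opprB E mulrAC mulr_le0_ge0 ?invr_ge0//.
  rewrite mulr_le0_ge0//; last lra.
  rewrite exprS mulr_le0_ge0 ?sqr_ge0//; lra.
- have [c] := MVT_ln_rat ltr01 t1; rewrite in_itv/= => /andP[c1 ct] ->.
  by rewrite mulr_ge0// ?divr_ge0// ?exprn_ge0//; lra.
Qed.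

Lemma phi_ge0 t : 0 <= t -> 0 <= phi t.
Proof.
move=> t0; have := phi_ge t0; have := sqr_ge0 (t - 1) => ? ?.
by rewrite -(@pmulr_rge0 _ (2 * (t + 2))); lra.
Qed.

Lemma phi_ge_le1 t : 0 <= t <= 1 -> (1 - t) ^+ 2 <= 2 * phi t.
Proof.
by case/andP=> t0 t1; have := phi_ge t0; have := phi_ge0 t0; nra.
Qed.

(** On this range [2 * (t + 2) <= 3 * (t + 1)]. *)
Lemma phi_ge_ge1 t : 1 <= t -> (t - 1) ^+ 2 <= (t + 1) * phi t.
Proof.
move=> t1; have /phi_ge : 0 <= t by lra.
have /phi_ge0 : 0 <= t by lra.
nra.
Qed.

End EntropyFunction.

Lemma ler_sqrW (R : realDomainType) (x y : R) : 0 <= x -> x <= y -> x ^+ 2 <= y ^+ 2.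
Proof. by move=> x0 xy; rewrite ler_sqr ?nnegrE// (le_trans x0). Qed.

(** * Weighted inequalities for a pair of densities *)

Section Weights.
Variables (R : realType) (c1 c2 : R).
Hypotheses (c1_gt1 : 1 < c1) (c2_gt1 : 1 < c2) (c12 : (c1 - 1) * (c2 - 1) = 1).
Implicit Types a b s u v w k : R.

(** The constraint on the weights reads [1 / c1 + 1 / c2 = 1], so this is Cauchy-Schwarz; the slack
    times [c1 - 1] is a perfect square. *)
Lemma sqrD_le_weighted u v : (u + v) ^+ 2 <= c1 * u ^+ 2 + c2 * v ^+ 2.
Proof.
rewrite -subr_ge0 -(@pmulr_rge0 _ (c1 - 1)) ?subr_gt0//.
have -> : (c1 - 1) * (c1 * u ^+ 2 + c2 * v ^+ 2 - (u + v) ^+ 2) =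
    ((c1 - 1) * u - v) ^+ 2 + ((c1 - 1) * (c2 - 1) - 1) * v ^+ 2 by ring.
by rewrite c12 subrr mul0r addr0 sqr_ge0.
Qed.

Definition phi2 a b := c1 * phi a + c2 * phi b.

Lemma phi2_ge0 a b : 0 <= a -> 0 <= b -> 0 <= phi2 a b.
Proof.
by move=> a0 b0; rewrite addr_ge0// mulr_ge0 ?phi_ge0//; have := c1_gt1; have := c2_gt1; lra.
Qed.

Lemma phi2_gel a b : 0 <= a -> 0 <= b -> phi a <= phi2 a b.
Proof.
move=> /phi_ge0 a0 /phi_ge0 b0; rewrite /phi2.
have := c1_gt1; have := c2_gt1; nra.
Qed.

Lemma phi2_ger a b : 0 <= a -> 0 <= b -> phi b <= phi2 a b.
Proof.
move=> /phi_ge0 a0 /phi_ge0 b0; rewrite /phi2.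
have := c1_gt1; have := c2_gt1; nra.
Qed.

(** When 1 is not strictly between [b] and [a], one of the two entropies suffices; otherwise the gap
    is cut at 1 and each piece is charged to its own entropy. *)
Lemma loss_le_phi2 a b : 0 <= b -> b <= a -> (a - b) ^+ 2 <= 2 * a * phi2 a b.
Proof.
move=> b0 ba; have a0 : 0 <= a by lra.
have [a1|a1] := leP a 1.
  apply: (@le_trans _ _ (a * (1 - b) ^+ 2)).
    have h1 : (a - b) ^+ 2 <= (a * (1 - b)) ^+ 2.
      apply: ler_sqrW; first by rewrite subr_ge0.
      by rewrite mulrBr mulr1 lerD2l lerN2 ler_piMl.
    apply: (le_trans h1); rewrite exprMn ler_wpM2r ?sqr_ge0//; nra.
  rewrite [2 * a]mulrC -mulrA ler_wpM2l//.
  apply: le_trans (phi_ge_le1 _) _; first lra.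
  by rewrite ler_pM2l// phi2_ger.
have pa : (a - 1) ^+ 2 <= 2 * a * phi a.
  have := phi_ge_ge1 (ltW a1); have := phi_ge0 a0; nra.
have [b1|b1] := leP 1 b.
  apply: (@le_trans _ _ ((a - 1) ^+ 2)); first by apply: ler_sqrW; lra.
  by apply: (le_trans pa); rewrite ler_wpM2l ?phi2_gel//; lra.
have pb : (1 - b) ^+ 2 <= 2 * phi b by apply: phi_ge_le1; lra.
have -> : a - b = (a - 1) + (1 - b) by ring.
apply: le_trans (sqrD_le_weighted _ _) _.
have := phi_ge0 b0; rewrite /phi2; have := c1_gt1; have := c2_gt1 => *.
have h1 : c1 * (a - 1) ^+ 2 <= c1 * (2 * a * phi a) by rewrite ler_wpM2l//; lra.
have h2 : c2 * (1 - b) ^+ 2 <= c2 * (2 * a * phi b).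
  by rewrite ler_wpM2l//; [lra | nra].
nra.
Qed.

(** Same case split at 1. The factor [2 + (b - a)] depends on the gap only, which is the form of the
    hypothesis of [offset_step]. *)
Lemma gain_le_phi2 a b : 0 <= a -> a <= b ->
  (b - a) ^+ 2 <= (2 + (b - a)) * phi2 a b.
Proof.
move=> a0 ab; have b0 : 0 <= b by lra.
have P0 := phi2_ge0 a0 b0.
have [b1|b1] := leP b 1.
  have pa := phi2_gel a0 b0; have /phi_ge_le1 q : 0 <= a <= 1 by lra.
  have h : (b - a) ^+ 2 <= (1 - a) ^+ 2 by apply: ler_sqrW; lra.
  rewrite mulrDl; have : 0 <= (b - a) * phi2 a b by rewrite mulr_ge0// subr_ge0.
  lra.
have [a1|a1] := leP 1 a.
  have hb := phi_ge_ge1 (ltW b1); have pb := phi2_ger a0 b0.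
  have hb' : (b - 1) ^+ 2 <= (b + 1) * phi2 a b.
    by apply: (le_trans hb); rewrite ler_wpM2l//; lra.
  (* The function [x^2 / (2 + x)] is increasing; it is compared at [b - a <= b - 1]. *)
  have h : (b - a) ^+ 2 * (b + 1) <= (b - 1) ^+ 2 * (2 + (b - a)).
    rewrite -subr_ge0.
    have -> : (b - 1) ^+ 2 * (2 + (b - a)) - (b - a) ^+ 2 * (b + 1)
      = (a - 1) * ((b - a) * (b - a + 4) + (a - 1) * (2 + (b - a))) by ring.
    have r0 : 0 <= a - 1 by lra.
    have s0 : 0 <= b - a by lra.
    have : 0 <= (b - a) * (b - a + 4) by apply: mulr_ge0 => //; lra.
    have : 0 <= (a - 1) * (2 + (b - a)) by apply: mulr_ge0 => //; lra.
    by move=> *; apply: mulr_ge0 => //; lra.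
  rewrite -(@ler_pM2r _ (b + 1)); last lra.
  apply: (le_trans h); rewrite mulrC -mulrA [phi2 _ _ * _]mulrC.
  by rewrite ler_wpM2l//; lra.
have -> : b - a = (1 - a) + (b - 1) by ring.
apply: le_trans (sqrD_le_weighted _ _) _.
have hb := phi_ge_ge1 (ltW b1); have /phi_ge_le1 ha : 0 <= a <= 1 by lra.
have := phi_ge0 a0; have := phi_ge0 b0.
rewrite /phi2; have := c1_gt1; have := c2_gt1 => *.
have h1 : c1 * (1 - a) ^+ 2 <= c1 * ((2 + (1 - a + (b - 1))) * phi a).
  by rewrite ler_wpM2l//; [lra | nra].
have h2 : c2 * (b - 1) ^+ 2 <= c2 * ((2 + (1 - a + (b - 1))) * phi b).
  by rewrite ler_wpM2l//; [lra | nra].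
lra.
Qed.

End Weights.

(* With [D = 1 + (k - 1) * s], [D] times the slack is
   [(D * a - k * s)^2 + 8 * D * w - k^2 * s^2], and [k^2 * (2 + s) <= 8 * D]. *)
Lemma offset_step (R : realType) (k a s w : R) : 5 / 4 <= k <= 2 -> 0 <= s -> 0 <= w ->
  s ^+ 2 <= (2 + s) * w ->
  2 * k * a * s - (k - 1) * a ^+ 2 * s <= a ^+ 2 + 8 * w.
Proof.
move=> /andP[k1 k2] s0 w0 sw; pose D := 1 + (k - 1) * s.
have D0 : 0 < D by rewrite /D; nra.
rewrite -subr_ge0 -(pmulr_rge0 _ D0).
have -> : D * (a ^+ 2 + 8 * w - (2 * k * a * s - (k - 1) * a ^+ 2 * s)) =
  (D * a - k * s) ^+ 2 + (8 * D * w - k ^+ 2 * s ^+ 2) by rewrite /D; ring.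
rewrite addr_ge0 ?sqr_ge0// subr_ge0.
apply: (@le_trans _ _ (k ^+ 2 * ((2 + s) * w))).
  by rewrite ler_wpM2l ?sqr_ge0.
rewrite mulrA ler_wpM2r// /D.
(* These compare the coefficients of 1 and of [s] in [k^2 * (2 + s) <= 8 * D]; the window
   [5/4 <= k <= 2] makes both hold. *)
have kk : k ^+ 2 <= 4 by nra.
have kl : k ^+ 2 <= 8 * (k - 1) by nra.
nra.
Qed.

(** The variance of [f] under the weights [w] is nonnegative. *)
Lemma jensen_sqr (R : realDomainType) (I : finType) (P : pred I) (w f : I -> R) :
  (forall i, P i -> 0 <= w i) -> \sum_(i | P i) w i = 1 ->
  (\sum_(i | P i) w i * f i) ^+ 2 <= \sum_(i | P i) w i * f i ^+ 2.
Proof.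
move=> w0 w1; set m := \sum_(i | P i) _.
have : 0 <= \sum_(i | P i) w i * (f i - m) ^+ 2.
  by apply: sumr_ge0 => i Pi; rewrite mulr_ge0 ?sqr_ge0 ?w0.
rewrite (eq_bigr (fun i => w i * f i ^+ 2 - 2 * m * (w i * f i) + m ^+ 2 * w i)); last first.
  by move=> i _; ring.
rewrite big_split sumrB -!mulr_sumr w1 -/m/= => H.
rewrite -subr_ge0; congr (0 <= _): H; ring.
Qed.

(** * A maximal coupling of two laws on a finite set, as a kernel *)

Section OneStep.
Variables (R : realType) (T : finType) (S : {set T}) (q1 q2 : T -> R).
Hypotheses (q1_ge0 : forall i, i \in S -> 0 <= q1 i) (q1_1 : \sum_(i in S) q1 i = 1).
Hypotheses (q2_ge0 : forall i, i \in S -> 0 <= q2 i) (q2_1 : \sum_(i in S) q2 i = 1).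

(** A point with [q1 i > 0] is kept with probability [min(1, q2 i / q1 i)], and otherwise moved to
    [j] with probability proportional to the excess of [q2 j] over [q1 j]. *)
Lemma maximal_coupling : exists P : T -> T -> R,
  [/\ forall i j, i \in S -> j \in S -> 0 <= P i j,
      forall i, i \in S -> \sum_(j in S) P i j = 1,
      forall j, j \in S -> \sum_(i in S) q1 i * P i j = q2 j
    & forall i, i \in S -> q1 i * (1 - P i i) = Num.max 0 (q1 i - q2 i)].
Proof.
pose l i := Num.max 0 (q1 i - q2 i).
pose g j := Num.max 0 (q2 j - q1 j).
pose t := \sum_(j in S) g j.
have l0 i : 0 <= l i by rewrite le_max lexx.
have g0 i : 0 <= g i by rewrite le_max lexx.
have lg i : l i * g i = 0.
  have [h|/ltW h] := leP (q1 i) (q2 i).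
    by rewrite /l max_l ?mul0r// subr_le0.
  by rewrite /g max_l ?mulr0// subr_le0.
have lBg i : l i - g i = q1 i - q2 i.
  by rewrite /l /g; case: leP => h1; case: leP => h2; lra.
have t0 : 0 <= t by apply: sumr_ge0.
have tl : \sum_(j in S) l j = t.
  apply/eqP; rewrite -subr_eq0 -sumrB (eq_bigr (fun j => q1 j - q2 j)) => [|j _]; last exact: lBg.
  by rewrite sumrB q1_1 q2_1 subrr.
have lq i : i \in S -> l i <= q1 i.
  by move=> iS; rewrite ge_max q1_ge0// gerBl q2_ge0.
(* If [t = 0] then [t / t = 0], but every excess [g j] vanishes too. *)
have tt j : g j * (t / t) = g j \/ j \notin S.
  have [jS|jS] := boolP (j \in S); [left|by right].
  have [t_0|tn0] := eqVneq t 0; last by rewrite divff// mulr1.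
  have : g j <= t by rewrite /t (bigD1 j)//= lerDl sumr_ge0.
  rewrite t_0 => gj; have -> : g j = 0 by have := g0 j; lra.
  by rewrite mul0r.
(* Where [q1 i = 0] the quotient is 0 and the point stays put. Since [l i * g i = 0], displaced mass
   never returns to its origin. *)
pose P i j := (i == j)%:R * (1 - l i / q1 i) + l i / q1 i * (g j / t).
exists P.
have lq1 i : i \in S -> 0 <= l i / q1 i <= 1.
  move=> iS; have := q1_ge0 iS; rewrite le_eqVlt => /predU1P[<-|q10].
    by rewrite invr0 mulr0 lexx ler01.
  by rewrite ler_pdivrMr// mul1r lq// andbT divr_ge0// ltW.
have qlq i : i \in S -> q1 i * (l i / q1 i) = l i.
  move=> iS; have := q1_ge0 iS; rewrite le_eqVlt => /predU1P[q10|q10].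
    by rewrite -q10 mul0r; have := lq _ iS; have := l0 i; rewrite -q10; lra.
  by rewrite mulrCA divff ?gt_eqF// mulr1.
have Pii i : P i i = 1 - l i / q1 i.
  rewrite /P eqxx mul1r; have -> : l i / q1 i * (g i / t) = (l i * g i) / (q1 i) / t.
    by rewrite !mulrA [_ * g i]mulrAC.
  by rewrite lg !mul0r addr0.
split=> [i j iS jS|i iS|j jS|i iS].
- case/andP: (lq1 i iS) => h1 h2.
  by rewrite addr_ge0// mulr_ge0// ?divr_ge0// subr_ge0.
- rewrite big_split/= -mulr_suml -mulr_sumr -mulr_suml -/t.
  rewrite (bigD1 i)//= eqxx big1 ?addr0 ?mul1r => [|j /andP[_ ji]]; last first.
    by rewrite eq_sym (negPf ji).
  have [t_0|tn0] := eqVneq t 0; last by rewrite divff// mulr1 subrK.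
  have li : l i <= t by rewrite -tl (bigD1 i)//= lerDl sumr_ge0.
  have -> : l i = 0 by have := l0 i; lra.
  by rewrite !mul0r subr0 addr0.
- rewrite (eq_bigr (fun i => q1 i * (i == j)%:R - l i * (i == j)%:R + l i * (g j / t))).
    rewrite big_split sumrB/= -mulr_suml tl (bigD1 j)//= eqxx big1 => [|i /andP[_ /negPf->]]; last by rewrite mulr0.
    rewrite (bigD1 j)//= eqxx big1 => [|i /andP[_ /negPf->]]; last by rewrite mulr0.
    rewrite mulrCA; case: (tt j) => [->|]; last by rewrite jS.
    by rewrite /= !mulr1 !addr0; have := lBg j; lra.
  by move=> i /qlq; rewrite /P; move: (l i / q1 i) => z <-; ring.
by rewrite Pii opprB addrC subrK qlq.
Qed.

End OneStep.

Lemma ler_sum_pred (R : numDomainType) (I : finType) (P Q : pred I) (F : I -> R) :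
  (forall i, P i -> Q i) -> (forall i, Q i -> 0 <= F i) ->
  \sum_(i | P i) F i <= \sum_(i | Q i) F i.
Proof.
move=> PQ F0; rewrite [leRHS](bigID P)/= (eq_bigl P) => [|i]; last first.
  by apply/andP/idP => [[]//|Pi]; split=> //; exact: PQ.
by rewrite lerDl; apply: sumr_ge0 => i /andP[/F0].
Qed.

Lemma sum_sqr_le (R : realDomainType) (I : finType) (P : pred I) (F : I -> R) :
  (forall i, P i -> 0 <= F i) ->
  \sum_(i | P i) F i ^+ 2 <= (\sum_(i | P i) F i) ^+ 2.
Proof.
move=> F0; rewrite [leRHS]expr2 mulr_suml; apply: ler_sum => i Pi.
rewrite expr2 ler_wpM2l ?F0// (bigD1 i)//= lerDl.
by apply: sumr_ge0 => j /andP[/F0].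
Qed.

(** * Entropy bounds for one step of the coupling *)

Section OneStepBounds.
Variables (R : realType) (c1 c2 : R).
Hypotheses (c1_gt1 : 1 < c1) (c2_gt1 : 1 < c2) (c12 : (c1 - 1) * (c2 - 1) = 1).
Variables (T : finType) (S : {set T}) (q1 q2 : T -> R).
Hypotheses (q1_ge0 : forall i, i \in S -> 0 <= q1 i) (q1_1 : \sum_(i in S) q1 i = 1).
Hypotheses (q2_ge0 : forall i, i \in S -> 0 <= q2 i) (q2_1 : \sum_(i in S) q2 i = 1).
Variable P : T -> T -> R.
Hypothesis P_ge0 : forall i j, i \in S -> j \in S -> 0 <= P i j.
Hypothesis P_1 : forall i, i \in S -> \sum_(j in S) P i j = 1.
Hypothesis P_q2 : forall j, j \in S -> \sum_(i in S) q1 i * P i j = q2 j.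
Hypothesis P_diag : forall i, i \in S -> q1 i * (1 - P i i) = Num.max 0 (q1 i - q2 i).

Local Notation N := (@GRing.natmul R 1 #|S|).
Local Notation w i := (phi2 c1 c2 (N * q1 i) (N * q2 i)).
Local Notation h := (N^-1 * \sum_(i in S) w i).

Let N_gt0 : 0 < N.
Proof.
rewrite ltr0n lt0n; apply/negP => /eqP/cards0_eq S0; move: q1_1.
by rewrite S0 big_set0 => /eqP; rewrite eq_sym oner_eq0.
Qed.

Let w_ge0 i : i \in S -> 0 <= w i.
Proof.
by move=> iS; apply: phi2_ge0 => //; rewrite mulr_ge0// ?q1_ge0 ?q2_ge0.
Qed.

(** Mass leaves only points with [q2 i < q1 i], so only those are charged; the entropy of the other
    points stays available for the gains. *)
Lemma step_loss :
  \sum_(i in S) q1 i * (1 - P i i) ^+ 2 <=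
  2 * N^-1 * \sum_(i in S | q2 i < q1 i) w i.
Proof.
rewrite (bigID (fun i => q2 i < q1 i))/= [X in _ + X]big1 ?addr0; last first.
  move=> i /andP[iS]; rewrite -leNgt => q12.
  by rewrite expr2 mulrA P_diag// max_l ?mul0r// subr_le0.
rewrite mulr_sumr; apply: ler_sum => i /andP[iS q12].
have q10 : 0 < q1 i by rewrite (le_lt_trans _ q12)// q2_ge0.
rewrite -(@ler_pM2l _ (N ^+ 2 * q1 i)) ?mulr_gt0 ?exprn_gt0//.
have -> : N ^+ 2 * q1 i * (q1 i * (1 - P i i) ^+ 2) = (N * q1 i - N * q2 i) ^+ 2.
  have := P_diag iS; rewrite max_r ?subr_ge0 ?(ltW q12)// => e.
  by rewrite -mulrBr -e; ring.
have -> : N ^+ 2 * q1 i * (2 / N * w i) = 2 * (N * q1 i) * w i.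
  by field; rewrite gt_eqF.
apply: loss_le_phi2 => //; first by rewrite mulr_ge0 ?q2_ge0.
by rewrite ler_pM2l// ltW.
Qed.

(** Pinsker's inequality compares each law with the uniform one; the triangle inequality and
    [sqrD_le_weighted] combine the two. *)
Lemma step_tv : (\sum_(i in S) q1 i * (1 - P i i)) ^+ 2 <= h / 2.
Proof.
have pinsker (q : T -> R) : (forall i, i \in S -> 0 <= q i) ->
    \sum_(i in S) q i = 1 ->
    (\sum_(i in S) `|q i - N^-1|) ^+ 2 <= 2 * (N^-1 * \sum_(i in S) phi (N * q i)).
  move=> q0 q_1; set u := \sum_(i in S) _.
  (* AM-GM together with [phi_ge]. Summed over [S], the factors [N * q i + 2] add up to [3 * N],
     which leaves half of [u^2] on the left. *)
  have pt i : i \in S -> u * (N * `|q i - N^-1|) <= u ^+ 2 / 6 * (N * q i + 2) + phi (N * q i).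
    move=> iS; have a0 : 0 <= N * q i by rewrite mulr_ge0 ?q0.
    have -> : N * `|q i - N^-1| = `|N * q i - 1|.
      by rewrite -{1}(gtr0_norm N_gt0) -normrM mulrBr divff// gt_eqF.
    move: (N * q i) a0 => a a0; rewrite -subr_ge0 -(@pmulr_rge0 _ (6 * (a + 2))); last lra.
    have := phi_ge a0; have := sqr_ge0 (u * (a + 2) - 3 * `|a - 1|).
    rewrite -[(a - 1) ^+ 2]real_normK ?num_real//; nra.
  have : \sum_(i in S) u * (N * `|q i - N^-1|) <=
      \sum_(i in S) (u ^+ 2 / 6 * (N * q i + 2) + phi (N * q i)) by exact: ler_sum.
  rewrite -!mulr_sumr -/u big_split/= -mulr_sumr big_split/= -mulr_sumr q_1.
  rewrite sumr_const -[2 *+ _]mulr_natl => H.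
  by rewrite mulrCA ler_pdivlMl//; lra.
(* The positive and negative parts of [q1 - q2] have equal mass. *)
have -> : \sum_(i in S) q1 i * (1 - P i i) = 2^-1 * \sum_(i in S) `|q1 i - q2 i|.
  have e : \sum_(i in S) (q1 i - q2 i) = 0 by rewrite sumrB q1_1 q2_1 subrr.
  rewrite -[X in _ = _ * X]addr0 -[X in _ = _ * (_ + X)]e -big_split/= mulr_sumr.
  apply: eq_bigr => i iS; rewrite P_diag//.
  by case: leP => q12; [rewrite ger0_norm// | rewrite ltr0_norm//]; lra.
set u := \sum_(i in S) `|q1 i - N^-1|; set v := \sum_(i in S) `|q2 i - N^-1|.
have uv : \sum_(i in S) `|q1 i - q2 i| <= u + v.
  rewrite -big_split/=; apply: ler_sum => i _.
  by rewrite [`|q2 i - _|]distrC; apply: ler_distD.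
have := pinsker _ q1_ge0 q1_1; have := pinsker _ q2_ge0 q2_1; rewrite -/u -/v.
have := sqrD_le_weighted c1_gt1 c12 u v.
have -> : h = c1 * (N^-1 * \sum_(i in S) phi (N * q1 i)) +
              c2 * (N^-1 * \sum_(i in S) phi (N * q2 i)).
  by rewrite /phi2 big_split/= -!mulr_sumr; ring.
move: (N^-1 * _) (N^-1 * _) => x y Huv Hv Hu.
have d0 : 0 <= \sum_(i in S) `|q1 i - q2 i| by apply: sumr_ge0.
have : (\sum_(i in S) `|q1 i - q2 i|) ^+ 2 <= (u + v) ^+ 2 by apply: ler_sqrW.
rewrite exprMn; have := c1_gt1; have := c2_gt1; nra.
Qed.

(** Here [k] is the coefficient of the potential left to later steps. The square of [j] counts with
    coefficient 1 if [j] is the chosen target and [k] otherwise, whence the weight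
    [P i j + k * (1 - P i j)]. The excess over [k * a j ^+ 2] is paid by the entropy, up to
    [a j ^+ 2 / N]. *)
Lemma step_gain (J : {set T}) (a : T -> R) (k : R) :
  J \subset S -> (forall j, j \in J -> 0 <= a j) -> 5 / 4 <= k <= 2 ->
  \sum_(i in S) q1 i * ((1 - P i i) ^+ 2 +
     \sum_(j in J | j != i) (a j + P i j) ^+ 2 * (P i j + k * (1 - P i j))) <=
  8 * h + (k + N^-1) * \sum_(j in J) a j ^+ 2.
Proof.
move=> JS a0 k12; case/andP: (k12) => k1 k2.
have SJ j : j \in J -> j \in S by move/(subsetP JS).
(* Mass arriving at [j] from the other points. *)
pose e j := \sum_(i in S | i != j) q1 i * P i j.
have eE j : j \in S -> e j = Num.max 0 (q2 j - q1 j).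
  move=> jS; have := P_q2 jS; rewrite (bigD1 j)//= -/(e j).
  have := P_diag jS; rewrite mulrBr mulr1.
  by case: leP => h1; case: leP => h2; lra.
have w8 j : j \in J -> (2 * k * a j - (k - 1) * a j ^+ 2) * e j <=
    N^-1 * a j ^+ 2 + 8 * N^-1 * (if q2 j < q1 j then 0 else w j).
  move=> jJ; have jS := SJ _ jJ.
  have NV : 0 < N^-1 by rewrite invr_gt0.
  have [q12|q12] := ltP (q2 j) (q1 j).
    rewrite eE// max_l ?subr_le0 ?(ltW q12)// !mulr0 addr0.
    by rewrite mulr_ge0 ?sqr_ge0// ltW.
  rewrite eE// max_r ?subr_ge0//.
  rewrite -(ler_pM2l N_gt0).
  have -> : N * (N^-1 * a j ^+ 2 + 8 / N * w j) = a j ^+ 2 + 8 * w j.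
    by field; rewrite gt_eqF.
  have -> : N * ((2 * k * a j - (k - 1) * a j ^+ 2) * (q2 j - q1 j)) =
    2 * k * a j * (N * q2 j - N * q1 j) - (k - 1) * a j ^+ 2 * (N * q2 j - N * q1 j) by ring.
  apply: offset_step => //; first by rewrite subr_ge0 ler_pM2l.
    exact: w_ge0.
  by apply: gain_le_phi2 => //; rewrite ?ler_pM2l// mulr_ge0 ?q1_ge0.
(* A nonnegative remainder is dropped, while the negative term [(k - 1) * a j ^+ 2 * P i j], the
   loss of potential, is kept. *)
have pt i j : i \in S -> j \in J ->
    (a j + P i j) ^+ 2 * (P i j + k * (1 - P i j)) <=
    k * a j ^+ 2 + (2 * k * a j - (k - 1) * a j ^+ 2) * P i j + k * P i j ^+ 2.
  move=> iS jJ; have := P_ge0 iS (SJ _ jJ); have := a0 _ jJ.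
  move: (a j) (P i j) => x p x0 p0; rewrite -subr_ge0.
  have -> : k * x ^+ 2 + (2 * k * x - (k - 1) * x ^+ 2) * p + k * p ^+ 2 -
    (x + p) ^+ 2 * (p + k * (1 - p)) = (k - 1) * (p ^+ 2 * (2 * x + p)) by ring.
  by rewrite mulr_ge0 ?mulr_ge0 ?sqr_ge0//; lra.
have loss := step_loss.
set L := \sum_(i in S) q1 i * (1 - P i i) ^+ 2 in loss.
(* Second-order gains are dominated by losses: a sum of squares is at most the square of the sum,
   here [1 - P i i]. *)
have sumP2 : \sum_(i in S) q1 i * \sum_(j in J | j != i) P i j ^+ 2 <= L.
  apply: ler_sum => i iS; rewrite ler_wpM2l ?q1_ge0//.
  have -> : 1 - P i i = \sum_(j in S | j != i) P i j.
    by rewrite -(P_1 iS) [in LHS](bigD1 i)//= addrC addrK.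
  apply: (@le_trans _ _ (\sum_(j in S | j != i) P i j ^+ 2)).
    apply: ler_sum_pred => [j /andP[/SJ -> ->]//|j _]; exact: sqr_ge0.
  by apply: sum_sqr_le => j /andP[jS _]; exact: P_ge0.
have e_sum : \sum_(j in J) (2 * k * a j - (k - 1) * a j ^+ 2) * e j <=
    N^-1 * \sum_(j in J) a j ^+ 2 + 8 * N^-1 * \sum_(j in S | ~~ (q2 j < q1 j)) w j.
  apply: (le_trans (ler_sum _ w8)); rewrite big_split/= -!mulr_sumr lerD2l.
  rewrite ler_wpM2l ?mulr_ge0 ?invr_ge0//.
  rewrite [leLHS](eq_bigr (fun j => if ~~ (q2 j < q1 j) then w j else 0)); last first.
    by move=> j _; case: ifP.
  rewrite -big_mkcondr/=; apply: ler_sum_pred => [j /andP[/SJ -> ->]//|j /andP[jS _]].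
  exact: w_ge0.
have hE : N^-1 * \sum_(j in S | q2 j < q1 j) w j +
    N^-1 * \sum_(j in S | ~~ (q2 j < q1 j)) w j = h.
  by rewrite [in RHS](bigID (fun j => q2 j < q1 j))/= mulrDr.
have main : \sum_(i in S) q1 i * \sum_(j in J | j != i)
      (a j + P i j) ^+ 2 * (P i j + k * (1 - P i j)) <=
    k * \sum_(j in J) a j ^+ 2 +
    \sum_(j in J) (2 * k * a j - (k - 1) * a j ^+ 2) * e j + k * L.
  apply: (@le_trans _ _ (\sum_(i in S) q1 i * \sum_(j in J | j != i)
     (k * a j ^+ 2 + (2 * k * a j - (k - 1) * a j ^+ 2) * P i j + k * P i j ^+ 2))).
    apply: ler_sum => i iS; rewrite ler_wpM2l ?q1_ge0//.
    by apply: ler_sum => j /andP[jJ _]; exact: pt.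
  under eq_bigr do rewrite 2!big_split/= 2!mulrDr.
  rewrite 2!big_split/= !lerD//.
  - under eq_bigr do rewrite -mulr_sumr mulrCA.
    rewrite -mulr_sumr ler_wpM2l//; first lra.
    rewrite -[leRHS]mul1r -q1_1 mulr_suml; apply: ler_sum => i iS.
    rewrite ler_wpM2l ?q1_ge0//; apply: ler_sum_pred => [j /andP[]//|j _].
    exact: sqr_ge0.
  - under eq_bigr do rewrite mulr_sumr.
    rewrite (exchange_big_dep (fun j => j \in J))/=; last by move=> i j _ /andP[].
    rewrite le_eqVlt; apply/orP; left; apply/eqP; apply: eq_bigr => j jJ.
    rewrite /e mulr_sumr; apply: eq_big => [i|i _]; last by rewrite mulrCA.
    by rewrite jJ/= eq_sym.
  - under eq_bigr do rewrite -mulr_sumr mulrCA.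
    by rewrite -mulr_sumr ler_wpM2l//; lra.
under eq_bigr do rewrite mulrDr.
rewrite big_split/= -/L.
have L0 : 0 <= L by apply: sumr_ge0 => i iS; rewrite mulr_ge0 ?q1_ge0 ?sqr_ge0.
(* In total [1 + k <= 3] copies of [L], each at most twice the entropy of the losing points: 6 is
   within the budget of 8. *)
have kL : k * L <= 2 * L by rewrite ler_wpM2r.
rewrite mulrDl -hE; move: main e_sum loss kL; rewrite -!mulrA; lra.
Qed.

End OneStepBounds.

(** * Subsets of fixed size and transpositions *)

Section Subsets.
Variable T : finType.
Implicit Types (S A x y z : {set T}) (i j l : T) (k : nat).

Definition ksub S k : {set {set T}} := [set A : {set T} | (A \subset S) && (#|A| == k)].

(** Sends subsets avoiding [i] to subsets avoiding [j], so that conditional laws living on different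
    complements become comparable. *)
Definition swp i j A : {set T} := tperm i j @: A.

Lemma in_swp i j A l : (l \in swp i j A) = (tperm i j l \in A).
Proof. by rewrite -[in LHS](tpermK i j l) mem_imset//; exact: perm_inj. Qed.

Lemma swpK i j : involutive (swp i j).
Proof. by move=> A; apply/setP=> l; rewrite !in_swp tpermK. Qed.

Lemma ksubU1 S k i x : i \in S ->
  (i |: x \in ksub S k.+1) && ((i |: x) :\ i == x) = (x \in ksub (S :\ i) k).
Proof.
move=> iS; rewrite !inE subUset sub1set iS/= subsetD1.
have [ix|ix] := boolP (i \in x).
  rewrite !andbF/=; apply/negP => /andP[_ /eqP e].
  by move: ix; rewrite -e !inE eqxx.
by rewrite setU1K// eqxx !andbT cardsU1 ix add1n eqSS.
Qed.

Lemma ksub_setU1 S k i x : i \in S -> x \in ksub (S :\ i) k -> i |: x \in ksub S k.+1.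
Proof. by move=> iS; rewrite -ksubU1// => /andP[]. Qed.

Lemma ksub_setU1K S k i x : i \in S -> x \in ksub (S :\ i) k -> (i |: x) :\ i = x.
Proof. by move=> iS; rewrite -ksubU1// => /andP[_ /eqP]. Qed.

Lemma ksub_setD1 S k i x : x \in ksub S k.+1 -> i \in x -> x :\ i \in ksub (S :\ i) k.
Proof.
move=> xS ix; have iS : i \in S by move: xS; rewrite inE => /andP[/subsetP/(_ _ ix)].
by rewrite -ksubU1// setD1K// xS eqxx.
Qed.

Lemma ksub_subset S k x i : x \in ksub S k -> i \in x -> i \in S.
Proof. by rewrite inE => /andP[/subsetP + _]; apply. Qed.

Lemma ksub_swp S k i j x : i \in S -> j \in S ->
  (swp i j x \in ksub (S :\ j) k) = (x \in ksub (S :\ i) k).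
Proof.
move=> iS jS; rewrite !inE card_imset; last exact: perm_inj.
congr andb; apply/subsetP/subsetP => h l.
  have := h (tperm i j l); rewrite in_swp tpermK => H /H; rewrite !inE.
  case: tpermP => [->|->|/eqP li /eqP lj] /andP[h1 h2]; rewrite ?h2 ?iS ?jS ?li ?lj//.
    by rewrite eqxx in h1.
  by rewrite eq_sym h1.
rewrite in_swp => /h; rewrite !inE.
case: tpermP => [->|->|/eqP li /eqP lj] /andP[h1 h2]; rewrite ?h2 ?iS ?jS ?li ?lj//.
  by rewrite eq_sym h1.
by rewrite eqxx in h1.
Qed.

(** Double counting of the pairs [i \in x], each pair being encoded by [i] and the rest of [x]. *)
Lemma sum_ksub_split (V : nmodType) S k (F : T -> {set T} -> V) :
  \sum_(x in ksub S k.+1) \sum_(i in x) F i x =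
  \sum_(i in S) \sum_(x in ksub (S :\ i) k) F i (i |: x).
Proof.
rewrite (exchange_big_dep (fun i => i \in S))/=; last first.
  by move=> x i xS; exact: ksub_subset xS.
apply: eq_bigr => i iS.
rewrite (reindex_onto (fun x => i |: x) (fun x => x :\ i))/=; last first.
  by move=> x /andP[_]; exact: setD1K.
by apply: eq_bigl => x; rewrite setU11 andbT ksubU1.
Qed.

Lemma sum_ksub_swp (V : nmodType) S k i j (F : {set T} -> V) : i \in S -> j \in S ->
  \sum_(x in ksub (S :\ i) k) F (swp i j x) = \sum_(x in ksub (S :\ j) k) F x.
Proof.
move=> iS jS; rewrite [RHS](reindex_inj (inv_inj (swpK i j))).
by apply: eq_bigl => x; rewrite ksub_swp.
Qed.

End Subsets.

(** * Disintegration along a random element, and the chain rule *)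

Section Entropy.
Variables (R : realType) (T : finType).
Implicit Types (S x y z : {set T}) (k : nat) (nu : {set T} -> R).

Definition kprob S k nu :=
  (forall x, x \in ksub S k -> 0 <= nu x) /\ \sum_(x in ksub S k) nu x = 1.

(* Relative entropy with respect to the uniform law on [ksub S k]. *)
Definition ent S k nu : R := \sum_(x in ksub S k) nu x * ln (nu x * 'C(#|S|, k)%:R).

(* [q] is the law of a uniformly random element of a random set of law [nu],
   and [nuc i] the law of the rest of the set given that this element is [i]. *)
Lemma kprob_disintegration S k nu : (k < #|S|)%N -> kprob S k.+1 nu ->
  exists (q : T -> R) (nuc : T -> {set T} -> R),
  [/\ forall i, i \in S -> 0 <= q i,
      \sum_(i in S) q i = 1,
      forall i, i \in S -> kprob (S :\ i) k (nuc i)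
    & forall i x, i \in S -> x \in ksub (S :\ i) k ->
        nu (i |: x) = k.+1%:R * q i * nuc i x].
Proof.
move=> kS [nu0 nu1].
pose q i := \sum_(x in ksub (S :\ i) k) nu (i |: x) / k.+1%:R.
have q0 i : i \in S -> 0 <= q i.
  by move=> iS; apply: sumr_ge0 => x xS; rewrite divr_ge0// nu0// ksub_setU1.
(* For [q i = 0] the conditional law is arbitrary; the uniform one keeps [nuc i] a probability. *)
pose nuc i x := if q i == 0 then #|ksub (S :\ i) k|%:R^-1 else nu (i |: x) / (k.+1%:R * q i).
exists q, nuc; split=> //.
- rewrite /q -(sum_ksub_split S k (fun i x => nu x / k.+1%:R)) -[RHS]nu1.
  apply: eq_bigr => x; rewrite inE => /andP[_ /eqP cx].
  by rewrite sumr_const cx -[LHS]mulr_natr divfK.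
- move=> i iS; split=> [x xS|]; rewrite /nuc.
    by case: ifP => _; rewrite ?invr_ge0// divr_ge0 ?mulr_ge0 ?q0// nu0// ksub_setU1.
  case: eqP => [_|/eqP qi].
    rewrite sumr_const -[LHS]mulr_natr mulVf// pnatr_eq0 cards_draws -lt0n bin_gt0.
    by move: kS; rewrite (cardsD1 i) iS add1n ltnS.
  rewrite -mulr_suml; apply: (@mulIf _ (k.+1%:R * q i)); first by rewrite mulf_neq0.
  by rewrite divfK ?mulf_neq0// mul1r /q -mulr_suml mulrC divfK.
- move=> i x iS xS; rewrite /nuc; case: eqP => [qi|/eqP qi].
    rewrite qi mulr0 mul0r; apply/eqP; rewrite -(@mulIr_eq0 _ k.+1%:R^-1); last first.
      by apply/mulIf; rewrite invr_eq0.
    apply/eqP/(psumr_eq0P _ qi) => // y yS.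
    by rewrite divr_ge0// nu0// ksub_setU1.
  by rewrite mulrC divfK// mulf_neq0.
Qed.

(** Each set is counted once per element with weight [1 / (k + 1)]. The logarithm of the density
    then splits because [(k + 1) * C(N, k + 1) = N * C(N - 1, k)]; null factors are treated
    apart. *)
Lemma ent_chain S k nu (q : T -> R) (nuc : T -> {set T} -> R) :
  (forall i, i \in S -> 0 <= q i) ->
  (forall i, i \in S -> kprob (S :\ i) k (nuc i)) ->
  (forall i x, i \in S -> x \in ksub (S :\ i) k ->
     nu (i |: x) = k.+1%:R * q i * nuc i x) ->
  ent S k.+1 nu = \sum_(i in S) q i * ln (q i * #|S|%:R) +
                  \sum_(i in S) q i * ent (S :\ i) k (nuc i).
Proof.
move=> q0 nuc1 nuE.
pose F x := nu x / k.+1%:R * ln (nu x * 'C(#|S|, k.+1)%:R).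
have -> : ent S k.+1 nu = \sum_(x in ksub S k.+1) \sum_(i in x) F x.
  apply: eq_bigr => x; rewrite inE => /andP[_ /eqP cx].
  by rewrite sumr_const cx -[RHS]mulr_natr /F mulrAC divfK.
rewrite (sum_ksub_split S k (fun=> F)) -big_split/=; apply: eq_bigr => i iS.
have [nuc0 nuc_1] := nuc1 i iS.
rewrite -[X in q i * X + _]mul1r -[X in X * ln _]nuc_1 -mulrDr mulr_suml -big_split/= mulr_sumr.
apply: eq_bigr => x xS.
rewrite /F nuE//.
have -> : k.+1%:R * q i * nuc i x / k.+1%:R = q i * nuc i x.
  by rewrite mulrC !mulrA mulVf// mul1r.
rewrite -mulrA; have := q0 i iS; rewrite le_eqVlt => /predU1P[<-|qi]; first by rewrite !mul0r.
have := nuc0 x xS; rewrite le_eqVlt => /predU1P[<-|nx]; first by rewrite !mul0r addr0 mulr0.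
congr (_ * _); rewrite -mulrDr; congr (_ * _).
have S0 : (0 < #|S|)%N by rewrite (cardD1 i) iS.
have C0 : (0 < 'C(#|S :\ i|, k))%N.
  rewrite -cards_draws card_gt0; apply/set0Pn; exists x.
  by move: xS; rewrite !inE.
rewrite -lnM ?posrE ?mulr_gt0 ?ltr0n//. congr ln.
have : (k.+1 * 'C(#|S|, k.+1) = #|S| * 'C(#|S :\ i|, k))%N.
  have -> : #|S :\ i| = #|S|.-1 by rewrite [in RHS](cardsD1 i) iS.
  by rewrite mul_bin_diag.
move=> /(congr1 (fun m => m%:R : R)); rewrite !natrM => e.
by transitivity (k.+1%:R * 'C(#|S|, k.+1)%:R * (q i * nuc i x)); [ring | rewrite e; ring].
Qed.

Lemma ent_swp S k nu i j : i \in S -> j \in S ->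
  ent (S :\ i) k (fun x => nu (swp i j x)) = ent (S :\ j) k nu.
Proof.
move=> iS jS; rewrite /ent -[RHS](sum_ksub_swp _ _ iS jS).
have -> // : #|S :\ i| = #|S :\ j|.
by have := cardsD1 i S; rewrite (cardsD1 j) iS jS !add1n => -[].
Qed.

Lemma kprob_swp S k nu i j : i \in S -> j \in S ->
  kprob (S :\ j) k nu -> kprob (S :\ i) k (fun x => nu (swp i j x)).
Proof.
move=> iS jS [nu0 nu1]; split=> [x xS|]; last by rewrite (sum_ksub_swp _ nu iS jS).
by rewrite nu0// ksub_swp.
Qed.

End Entropy.

(** * Gluing the coupling of the first elements with kernels for the rest *)

Section Glue.
Variables (R : realType) (T : finType) (S : {set T}) (k : nat).
Variables (P : T -> T -> R) (K : T -> T -> {set T} -> {set T} -> R).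
Hypothesis P_ge0 : forall i j, i \in S -> j \in S -> 0 <= P i j.
Hypothesis P_1 : forall i, i \in S -> \sum_(j in S) P i j = 1.
Hypothesis K_kprob : forall i j x, i \in S -> j \in S -> x \in ksub (S :\ i) k ->
  kprob (S :\ i) k (K i j x).
Implicit Types (x y z J : {set T}) (i j l : T).

Definition ev S k (m : {set T} -> R) (Q : pred {set T}) : R :=
  \sum_(y in ksub S k) m y * (Q y)%:R.

(* Couple the first elements [i], [j] by [P], the rest by [K i j], and undo the
   transposition which brought the target back to [S :\ i]. *)
Definition glue x y : R := k.+1%:R^-1 * \sum_(i in x) \sum_(j in S) P i j *
  \sum_(z in ksub (S :\ i) k) K i j (x :\ i) z * (y == j |: swp i j z)%:R.

Lemma sum_glue x (f : {set T} -> R) : x \in ksub S k.+1 ->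
  \sum_(y in ksub S k.+1) glue x y * f y =
  k.+1%:R^-1 * \sum_(i in x) \sum_(j in S) P i j *
    \sum_(z in ksub (S :\ i) k) K i j (x :\ i) z * f (j |: swp i j z).
Proof.
move=> xS; under eq_bigr do rewrite /glue -mulrA mulr_suml.
rewrite -mulr_sumr; congr (_ * _); rewrite exchange_big/=.
apply: eq_bigr => i ix; have iS := ksub_subset xS ix.
under eq_bigr do rewrite mulr_suml.
rewrite exchange_big/=; apply: eq_bigr => j jS.
under eq_bigr do rewrite -mulrA mulr_suml.
rewrite -mulr_sumr exchange_big/=; congr (_ * _); apply: eq_bigr => z zS.
rewrite (bigD1 (j |: swp i j z))/=; last by rewrite ksub_setU1// ksub_swp.
by rewrite eqxx mulr1 big1 ?addr0// => y /andP[_ /negPf->]; rewrite mulr0 mul0r.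
Qed.

Lemma glue_kprob x : x \in ksub S k.+1 -> kprob S k.+1 (glue x).
Proof.
move=> xS; split=> [y yS|].
  rewrite mulr_ge0 ?invr_ge0//; apply: sumr_ge0 => i ix; apply: sumr_ge0 => j jS.
  have iS := ksub_subset xS ix.
  rewrite mulr_ge0 ?P_ge0//; apply: sumr_ge0 => z zS; rewrite mulr_ge0//.
  by apply: (K_kprob iS jS _).1 => //; exact: ksub_setD1.
transitivity (\sum_(y in ksub S k.+1) glue x y * (fun=> 1) y).
  by apply: eq_bigr => y _; rewrite /= mulr1.
rewrite sum_glue//=.
have cx : #|x| = k.+1 by move: xS; rewrite inE => /andP[_ /eqP].
rewrite (eq_bigr (fun=> 1)) => [|i ix]; first by rewrite sumr_const cx mulVf.
have iS := ksub_subset xS ix.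
rewrite -[RHS](P_1 iS); apply: eq_bigr => j jS.
under eq_bigr do rewrite mulr1.
by rewrite (K_kprob iS jS _).2 ?mulr1//; exact: ksub_setD1.
Qed.

Lemma ev_ge0 S' k' (m : {set T} -> R) Q : kprob S' k' m -> 0 <= ev S' k' m Q.
Proof. by move=> [m0 _]; apply: sumr_ge0 => y yS; rewrite mulr_ge0// m0. Qed.

Lemma ev_le1 S' k' (m : {set T} -> R) Q : kprob S' k' m -> ev S' k' m Q <= 1.
Proof.
move=> [m0 <-]; apply: ler_sum => y yS; rewrite ler_piMr ?m0//.
by rewrite lern1; case: (Q y).
Qed.

Let miss i j x l : R := ev (S :\ i) k (K i j x) (fun y => l \notin y).
Let hit i j x l : R := ev (S :\ i) k (K i j x) (fun y => l \in y).

(** If [l = i], a loss forces [j != i]. If [l != i], nothing is lost when [l = j], and otherwise the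
    transposition fixes [l], so the loss comes from the rest. *)
Lemma glue_miss x l : x \in ksub S k.+1 -> l \in x ->
  ev S k.+1 (glue x) (fun y => l \notin y) <=
  k.+1%:R^-1 * \sum_(i in x)
    (if l == i then 1 - P i i else \sum_(j in S) P i j * miss i j (x :\ i) l).
Proof.
move=> xS lx; rewrite /ev sum_glue// ler_wpM2l ?invr_ge0//.
apply: ler_sum => i ix; have iS := ksub_subset xS ix.
have xi := ksub_setD1 xS ix.
case: (eqVneq l i) => [->|li].
  have -> : 1 - P i i = \sum_(j in S | j != i) P i j.
    by rewrite -(P_1 iS) [in LHS](bigD1 i)//= addrC addrK.
  rewrite (bigD1 i)//= [X in _ * X + _]big1 ?mulr0 ?add0r => [|z _]; last first.
    by rewrite setU11 mulr0.
  apply: ler_sum => j /andP[jS ji].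
  by rewrite ler_piMr ?P_ge0//; apply: ev_le1 (fun z => i \notin j |: swp i j z) (K_kprob _ _ _).
apply: ler_sum => j jS; rewrite ler_wpM2l ?P_ge0//; apply: ler_sum => z zS.
have [K0 _] := K_kprob iS jS xi; rewrite ler_wpM2l ?K0// ler_nat.
rewrite !inE in_swp negb_or.
by case: (eqVneq l j) => //= lj; rewrite tpermD// eq_sym.
Qed.

(** Since [l] is not in [x], it differs from [i]: either [l] is the target [j], or the transposition
    fixes [l] and the rest must hit it. *)
Lemma glue_hit x l : x \in ksub S k.+1 -> l \in S -> l \notin x ->
  ev S k.+1 (glue x) (fun y => l \in y) =
  k.+1%:R^-1 * \sum_(i in x)
    (P i l + \sum_(j in S | j != l) P i j * hit i j (x :\ i) l).
Proof.
move=> xS lS lx; rewrite /ev sum_glue//; congr (_ * _).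
apply: eq_bigr => i ix; have iS := ksub_subset xS ix.
have xi := ksub_setD1 xS ix.
have li : l != i by apply: contraNneq lx => ->.
rewrite (bigD1 l)//=; congr (_ + _).
  rewrite (eq_bigr (K i l (x :\ i))) => [|z _]; last by rewrite setU11 mulr1.
  by rewrite (K_kprob iS lS xi).2 mulr1.
apply: eq_bigr => j /andP[jS jl]; congr (_ * _); apply: eq_bigr => z _.
by rewrite !inE in_swp eq_sym (negPf jl)/= tpermD// eq_sym.
Qed.

Lemma sum_pick x i (F : T -> R) c : i \in x ->
  \sum_(l in x) (if l == i then c else F l) = c + \sum_(l in x :\ i) F l.
Proof.
move=> ix; rewrite (bigD1 i)//= eqxx; congr (_ + _).
by apply: eq_big => [l|l /andP[_ /negPf->]//]; rewrite !inE andbC.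
Qed.

Lemma glue_loss x : x \in ksub S k.+1 ->
  \sum_(l in x) ev S k.+1 (glue x) (fun y => l \notin y) <=
  k.+1%:R^-1 * \sum_(i in x) (1 - P i i +
    \sum_(j in S) P i j * \sum_(l in x :\ i) miss i j (x :\ i) l).
Proof.
move=> xS; apply: le_trans (ler_sum _ (fun l => glue_miss xS)) _.
rewrite -mulr_sumr exchange_big/= ler_wpM2l ?invr_ge0//.
apply: ler_sum => i ix; rewrite sum_pick// lerD2l exchange_big/=.
by apply: ler_sum => j _; rewrite mulr_sumr.
Qed.

Lemma jensen_avg x (f : T -> R) : x \in ksub S k.+1 ->
  (k.+1%:R^-1 * \sum_(i in x) f i) ^+ 2 <= k.+1%:R^-1 * \sum_(i in x) f i ^+ 2.
Proof.
move=> xS; have cx : #|x| = k.+1 by move: xS; rewrite inE => /andP[_ /eqP].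
rewrite !mulr_sumr; apply: (jensen_sqr (w := fun=> k.+1%:R^-1)) => [i _|].
  by rewrite invr_ge0.
by rewrite sumr_const cx -[LHS]mulr_natr mulVf.
Qed.

(** Jensen's inequality twice, over the uniform [i] in [x] and over [j] given [i]. The term [l = i]
    does not depend on [j] and is squared as it stands. *)
Lemma glue_loss2 x : x \in ksub S k.+1 ->
  \sum_(l in x) ev S k.+1 (glue x) (fun y => l \notin y) ^+ 2 <=
  k.+1%:R^-1 * \sum_(i in x) ((1 - P i i) ^+ 2 +
    \sum_(j in S) P i j * \sum_(l in x :\ i) miss i j (x :\ i) l ^+ 2).
Proof.
move=> xS; pose G i l := if l == i then (1 - P i i) ^+ 2
  else \sum_(j in S) P i j * miss i j (x :\ i) l ^+ 2.
apply: (@le_trans _ _ (\sum_(l in x) k.+1%:R^-1 * \sum_(i in x) G i l)).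
  apply: ler_sum => l lx.
  apply: le_trans (ler_sqrW (ev_ge0 _ (glue_kprob xS)) (glue_miss xS lx)) _.
  apply: le_trans (jensen_avg _ xS) _; rewrite ler_wpM2l ?invr_ge0//.
  apply: ler_sum => i ix; rewrite /G; case: ifP => // _.
  have iS := ksub_subset xS ix.
  by apply: jensen_sqr => [j jS|]; [exact: P_ge0|exact: P_1].
rewrite -mulr_sumr exchange_big/= ler_wpM2l ?invr_ge0//.
apply: ler_sum => i ix; rewrite /G sum_pick// lerD2l exchange_big/=.
by apply: ler_sum => j _; rewrite mulr_sumr.
Qed.

(** Jensen's inequality over [i] and [j], with [P i l] kept constant in [j] in place of the
    indicator of [j = l]. It thus joins the offset: the rest faces the offsets [a l + P i l], and
    only the chosen [j] is split off. *)
Lemma glue_gain2 x J (a : T -> R) : x \in ksub S k.+1 -> J \subset S ->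
  (forall l, l \in J -> 0 <= a l) ->
  \sum_(l in J | l \notin x) (a l + ev S k.+1 (glue x) (fun y => l \in y)) ^+ 2 <=
  k.+1%:R^-1 * \sum_(i in x) \sum_(j in S) P i j *
   ((if (j \in J) && (j != i) then (a j + P i j) ^+ 2 else 0) +
    \sum_(l in J :\ i :\ j | l \notin x :\ i)
       (a l + P i l + hit i j (x :\ i) l) ^+ 2).
Proof.
move=> xS JS a0.
have cx : #|x| = k.+1 by move: xS; rewrite inE => /andP[_ /eqP].
have avgc c : c = k.+1%:R^-1 * \sum_(i in x) c :> R.
  by rewrite sumr_const cx -[c *+ _]mulr_natl mulrA mulVf ?mul1r.
apply: (@le_trans _ _ (\sum_(l in J | l \notin x) k.+1%:R^-1 *
   \sum_(i in x) \sum_(j in S) P i j * (a l + P i l +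
      (if j == l then 0 else hit i j (x :\ i) l)) ^+ 2)).
  apply: ler_sum => l /andP[lJ lx]; rewrite glue_hit//; last exact: (subsetP JS).
  rewrite [X in X + _]avgc -mulrDr -big_split/=.
  apply: le_trans (jensen_avg _ xS) _; rewrite ler_wpM2l ?invr_ge0//.
  apply: ler_sum => i ix; have iS := ksub_subset xS ix.
  have := jensen_sqr (fun j => a l + P i l +
    (if j == l then 0 else hit i j (x :\ i) l)) (fun j => @P_ge0 i j iS) (P_1 iS).
  apply: le_trans; rewrite le_eqVlt; apply/orP; left; apply/eqP; congr (_ ^+ 2).
  under [RHS]eq_bigr do rewrite mulrDr.
  rewrite big_split/= -mulr_suml P_1// mul1r addrA; congr (_ + _).
  rewrite [LHS]big_mkcondr/=; apply: eq_bigr => j _.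
  by case: eqP => _/=; rewrite ?mulr0.
rewrite -mulr_sumr exchange_big/= ler_wpM2l ?invr_ge0//.
apply: ler_sum => i ix; rewrite exchange_big/=; apply: ler_sum => j jS.
have iS := ksub_subset xS ix.
rewrite -mulr_sumr ler_wpM2l ?P_ge0//.
rewrite (bigID (fun l => l == j))/= lerD//.
  case: ifP => [/andP[jJ ji]|jJ].
    rewrite big_mkcondl big_pred1_eq eqxx addr0; case: ifP => // _.
    exact: sqr_ge0.
  rewrite big1// => l /andP[/andP[lJ lx] /eqP lj].
  move: jJ lx; rewrite -lj lJ/= => /negbT; rewrite negbK => /eqP->.
  by rewrite ix.
rewrite (eq_bigr (fun l => (a l + P i l + hit i j (x :\ i) l) ^+ 2)); last first.
  by move=> l /andP[_ lj]; rewrite eq_sym (negPf lj).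
apply: ler_sum_pred => [l /andP[/andP[lJ lx] lj]|l _]; last exact: sqr_ge0.
rewrite !inE lj lJ (negPf lx) !andbF !andbT/=.
by apply: contraNneq lx => ->.
Qed.

End Glue.

(** * A partial harmonic sum, and entropy as a mean of [phi] *)

Lemma sum_inv_half (R : realFieldType) k N : (k.*2 <= N)%N ->
  \sum_(l < k) (N - l)%:R^-1 <= 3 / 4 :> R.
Proof.
move=> kN; have [->|k0] := posnP k; first by rewrite big_ord0; lra.
(* Each term is paired with its mirror image under [l -> k - 1 - l]; as [2 * k <= N], every pair is
   at most [3 / (2 * k)]. *)
suff H : \sum_(l < k) ((N - l)%:R^-1 + (N - (k - l.+1))%:R^-1) <= 3 / 2 :> R.
  have e : \sum_(l < k) (N - (k - l.+1))%:R^-1 = \sum_(l < k) (N - l)%:R^-1 :> R.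
    by rewrite [RHS](reindex_inj rev_ord_inj).
  by move: H; rewrite big_split/= e; lra.
have -> : 3 / 2 = \sum_(l < k) (3 / (2 * k%:R)) :> R.
  by rewrite sumr_const card_ord -[RHS]mulr_natr; field; rewrite pnatr_eq0 -lt0n.
apply: ler_sum => l _; have lk := ltn_ord l.
have [A EA] : exists A, A = (N - l)%N by exists (N - l)%N.
have [B EB] : exists B, B = (N - (k - l.+1))%N by exists (N - (k - l.+1))%N.
rewrite -EA -EB.
have A0 : (0 < A)%N by lia.
have B0 : (0 < B)%N by lia.
rewrite -(@natrM _ 2) -[_%:R^-1 + _](@mulfK _ (A * B)%:R); last by rewrite pnatr_eq0; lia.
have -> : (A%:R^-1 + B%:R^-1) * (A * B)%:R = (A + B)%:R :> R.
  by rewrite natrD natrM; field; rewrite !pnatr_eq0 -!lt0n A0 B0.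
rewrite ler_pdivrMr ?ltr0n ?muln_gt0 ?A0// mulrAC ler_pdivlMr ?ltr0n; last by lia.
rewrite -!natrM ler_nat; nia.
Qed.

Lemma sum_ksub0 (V : nmodType) (T : finType) (S : {set T}) (F : {set T} -> V) :
  \sum_(x in ksub S 0) F x = F set0.
Proof.
rewrite (big_pred1 set0)// => x; rewrite !inE cards_eq0/= andbC.
by case: eqVneq => //= ->; rewrite sub0set.
Qed.

(** The affine part of [phi] averages to 0 because [q] has total mass 1. *)
Lemma sum_phi (R : realType) (T : finType) (S : {set T}) (q : T -> R) :
  \sum_(i in S) q i = 1 ->
  #|S|%:R^-1 * \sum_(i in S) phi (#|S|%:R * q i) =
  \sum_(i in S) q i * ln (q i * #|S|%:R).
Proof.
move=> q_1.
have S0 : #|S|%:R != 0 :> R.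
  rewrite pnatr_eq0; apply/eqP => /cards0_eq S0; move/eqP: q_1.
  by rewrite S0 big_set0 eq_sym oner_eq0.
rewrite /phi big_split sumrB/= -[X in _ - X]mulr_sumr q_1 sumr_const mulr1 subrK.
rewrite mulr_sumr; apply: eq_bigr => i _.
by rewrite !mulrA mulVf// mul1r [_ * q i]mulrC.
Qed.

(** * The invariant of the induction and its inductive step *)

Section Main.
Variables (R : realType) (c1 c2 : R) (T : finType).
Hypotheses (c1_gt1 : 1 < c1) (c2_gt1 : 1 < c2) (c12 : (c1 - 1) * (c2 - 1) = 1).
Implicit Types (S x y J : {set T}) (k : nat) (nu : {set T} -> R).

Lemma sum_phi2 S (q1 q2 : T -> R) :
  \sum_(i in S) q1 i = 1 -> \sum_(i in S) q2 i = 1 ->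
  #|S|%:R^-1 * \sum_(i in S) phi2 c1 c2 (#|S|%:R * q1 i) (#|S|%:R * q2 i) =
  c1 * \sum_(i in S) q1 i * ln (q1 i * #|S|%:R) +
  c2 * \sum_(i in S) q2 i * ln (q2 i * #|S|%:R).
Proof.
move=> q1_1 q2_1.
by rewrite -!sum_phi// /phi2 big_split/= -!mulr_sumr; ring.
Qed.

Lemma kprob_avg S k nu (q : T -> R) (nuc : T -> {set T} -> R) (G : T -> {set T} -> R) :
  (forall i x, i \in S -> x \in ksub (S :\ i) k ->
     nu (i |: x) = k.+1%:R * q i * nuc i x) ->
  \sum_(x in ksub S k.+1) nu x * (k.+1%:R^-1 * \sum_(i in x) G i (x :\ i)) =
  \sum_(i in S) q i * \sum_(x in ksub (S :\ i) k) nuc i x * G i x.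
Proof.
move=> nuE.
under eq_bigr do rewrite mulrA mulr_sumr.
rewrite (sum_ksub_split S k (fun i x => nu x / k.+1%:R * G i (x :\ i))).
apply: eq_bigr => i iS; rewrite mulr_sumr; apply: eq_bigr => x xS.
rewrite nuE// (ksub_setU1K iS xS).
have -> : k.+1%:R * q i * nuc i x / k.+1%:R = q i * nuc i x.
  by rewrite mulrC !mulrA mulVf// mul1r.
by rewrite mulrA.
Qed.

Definition weighted_ent S k nu1 nu2 := c1 * ent S k nu1 + c2 * ent S k nu2.

(** Coefficient of the potential with [N] points and [k] steps left: a step with [N] points costs
    [1 / N]. The base value 5/4 is the lower end of the window in [offset_step], and [sum_inv_half]
    keeps the total within its upper end 2. *)
Definition kappa N k : R := 5 / 4 + \sum_(l < k) (N - l)%:R^-1.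

Definition loss S k (p : {set T} -> {set T} -> R) x l :=
  ev S k (p x) (fun y => l \notin y).

Definition gain S k (p : {set T} -> {set T} -> R) x l :=
  ev S k (p x) (fun y => l \in y).

(** The three bounds serve [W1], [T2tilde] and [T2hat] in turn. The last one leaves [J] and the
    offsets free, since a step removes [i] and [j] from [J] and raises the offsets; its final use
    takes [J] full and zero offsets. *)
Definition good_kernel S k nu1 nu2 (p : {set T} -> {set T} -> R) :=
  [/\ forall x, x \in ksub S k -> kprob S k (p x),
      forall y, y \in ksub S k -> \sum_(x in ksub S k) nu1 x * p x y = nu2 y,
      (\sum_(x in ksub S k) nu1 x * \sum_(l in x) loss S k p x l) ^+ 2 <=
        k%:R / 2 * weighted_ent S k nu1 nu2,
      \sum_(x in ksub S k) nu1 x * \sum_(l in x) loss S k p x l ^+ 2 <=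
        2 * weighted_ent S k nu1 nu2
    & forall J (a : T -> R), J \subset S -> (forall l, l \in J -> 0 <= a l) ->
      \sum_(x in ksub S k) nu1 x * (\sum_(l in x) loss S k p x l ^+ 2 +
         \sum_(l in J | l \notin x) (a l + gain S k p x l) ^+ 2) <=
        8 * weighted_ent S k nu1 nu2 + kappa #|S| k * \sum_(l in J) a l ^+ 2].

Lemma good_kernel0 S nu1 nu2 : kprob S 0 nu1 -> kprob S 0 nu2 ->
  good_kernel S 0 nu1 nu2 (fun _ _ => 1).
Proof.
rewrite /good_kernel /kprob /weighted_ent /ent !sum_ksub0 => -[_ nu1_1] [_ nu2_1].
have K0 x : x \in ksub S 0 -> x = set0 by rewrite !inE cards_eq0 => /andP[_ /eqP].
have w0 : c1 * (nu1 set0 * ln (nu1 set0 * 'C(#|S|, 0)%:R)) + c2 * (nu2 set0 * ln (nu2 set0 * 'C(#|S|, 0)%:R)) = 0.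
  by rewrite bin0 nu1_1 nu2_1 !mulr1 ln1 !mulr0 addr0.
rewrite w0 !big_set0; split=> [x _|y /K0->||| J a JS a0].
- by split=> // _ _; exact: ler01.
- by rewrite nu1_1 nu2_1 mulr1.
- by rewrite !mulr0 expr0n.
- by rewrite !mulr0.
rewrite sum_ksub0 nu1_1 big_set0 mulr0 add0r mul1r add0r /kappa big_ord0 addr0.
rewrite (eq_bigl (mem J)) => [|l]; last by rewrite inE andbT.
rewrite (eq_bigr (fun l => a l ^+ 2)) => [|l lJ].
  by rewrite ler_peMl ?sumr_ge0// => [l _|]; [exact: sqr_ge0|lra].
by rewrite /gain /ev sum_ksub0 inE mulr0 addr0.
Qed.

Section Step.
Variables (S : {set T}) (k : nat) (nu1 nu2 : {set T} -> R).
Hypothesis kS : (k.+1.*2 <= #|S|)%N.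
Hypotheses (nu1_ge0 : forall x, x \in ksub S k.+1 -> 0 <= nu1 x).
Variables (q1 q2 : T -> R) (n1 n2 : T -> {set T} -> R).
Hypotheses (q1_ge0 : forall i, i \in S -> 0 <= q1 i) (q1_1 : \sum_(i in S) q1 i = 1).
Hypotheses (q2_ge0 : forall i, i \in S -> 0 <= q2 i) (q2_1 : \sum_(i in S) q2 i = 1).
Hypothesis n1_kprob : forall i, i \in S -> kprob (S :\ i) k (n1 i).
Hypothesis n2_kprob : forall i, i \in S -> kprob (S :\ i) k (n2 i).
Hypothesis n1E : forall i x, i \in S -> x \in ksub (S :\ i) k ->
  nu1 (i |: x) = k.+1%:R * q1 i * n1 i x.
Hypothesis n2E : forall i x, i \in S -> x \in ksub (S :\ i) k ->
  nu2 (i |: x) = k.+1%:R * q2 i * n2 i x.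
Variable P : T -> T -> R.
Hypothesis P_ge0 : forall i j, i \in S -> j \in S -> 0 <= P i j.
Hypothesis P_1 : forall i, i \in S -> \sum_(j in S) P i j = 1.
Hypothesis P_q2 : forall j, j \in S -> \sum_(i in S) q1 i * P i j = q2 j.
Hypothesis P_diag : forall i, i \in S -> q1 i * (1 - P i i) = Num.max 0 (q1 i - q2 i).
Variable K : T -> T -> {set T} -> {set T} -> R.
Hypothesis K_good : forall i j, i \in S -> j \in S ->
  good_kernel (S :\ i) k (n1 i) (fun x => n2 j (swp i j x)) (K i j).

Local Notation p := (glue S k P K).
Local Notation N := (@GRing.natmul R 1 #|S|).
Local Notation h := (N^-1 * \sum_(i in S) phi2 c1 c2 (N * q1 i) (N * q2 i)).
Local Notation E i j := (weighted_ent (S :\ i) k (n1 i) (fun x => n2 j (swp i j x))).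

Let K_kprob i j x : i \in S -> j \in S -> x \in ksub (S :\ i) k ->
  kprob (S :\ i) k (K i j x).
Proof. by move=> iS jS xS; have [+ _ _ _ _] := K_good iS jS; apply. Qed.

(** [K i j] carries [n1 i] to the pulled-back [n2 j], and the transposition in [glue] undoes the
    pull-back; [P] turns [q1] into [q2]. *)
Lemma glue_marginal y : y \in ksub S k.+1 ->
  \sum_(x in ksub S k.+1) nu1 x * p x y = nu2 y.
Proof.
move=> yS.
rewrite (kprob_avg (fun i x => \sum_(j in S) P i j *
  \sum_(z in ksub (S :\ i) k) K i j x z * (y == j |: swp i j z)%:R) n1E).
transitivity (\sum_(i in S) \sum_(j in S) q1 i * P i j *
    \sum_(z in ksub (S :\ j) k) n2 j z * (y == j |: z)%:R).
  apply: eq_bigr => i iS; under eq_bigr do rewrite mulr_sumr.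
  rewrite exchange_big/= mulr_sumr; apply: eq_bigr => j jS.
  rewrite -mulrA; congr (_ * _).
  under eq_bigr do rewrite mulrCA mulr_sumr.
  rewrite -mulr_sumr exchange_big/=; congr (_ * _).
  rewrite -(sum_ksub_swp k (fun z => n2 j z * (y == j |: z)%:R) iS jS).
  apply: eq_bigr => z zS; have [_ K2 _ _ _] := K_good iS jS.
  by rewrite -K2// mulr_suml; apply: eq_bigr => x _; rewrite mulrA.
rewrite exchange_big/=.
transitivity (\sum_(j in S) \sum_(z in ksub (S :\ j) k)
    nu2 (j |: z) / k.+1%:R * (y == j |: z)%:R).
  apply: eq_bigr => j jS; rewrite -mulr_suml P_q2// mulr_sumr.
  apply: eq_bigr => z zS; rewrite n2E// mulrA; congr (_ * _).
  by rewrite [RHS]mulrC !mulrA mulVf// mul1r.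
rewrite -(sum_ksub_split S k (fun _ z => nu2 z / k.+1%:R * (y == z)%:R)).
rewrite (bigD1 y)//= [X in _ + X]big1 => [|x /andP[_ /negPf xy]].
  have cy : #|y| = k.+1 by move: yS; rewrite inE => /andP[_ /eqP].
  by rewrite addr0 sumr_const cy eqxx mulr1 -[LHS]mulr_natr divfK.
by rewrite big1// => i _; rewrite eq_sym xy mulr0.
Qed.

(** The entropy of a conditional law of [nu2] is invariant under the transposition and is averaged
    over [j], whose law is [q2]. *)
Lemma weighted_ent_chain :
  weighted_ent S k.+1 nu1 nu2 = h + \sum_(i in S) q1 i * \sum_(j in S) P i j * E i j.
Proof.
rewrite /weighted_ent (ent_chain q1_ge0 n1_kprob n1E) (ent_chain q2_ge0 n2_kprob n2E).
rewrite sum_phi2//.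
have -> : \sum_(i in S) q1 i * \sum_(j in S) P i j * E i j =
    c1 * (\sum_(i in S) q1 i * ent (S :\ i) k (n1 i)) +
    c2 * (\sum_(i in S) q2 i * ent (S :\ i) k (n2 i)).
  transitivity (\sum_(i in S) (c1 * (q1 i * ent (S :\ i) k (n1 i)) +
     c2 * \sum_(j in S) q1 i * P i j * ent (S :\ j) k (n2 j))).
    apply: eq_bigr => i iS.
    rewrite (eq_bigr (fun j => c1 * ent (S :\ i) k (n1 i) * P i j +
       c2 * (P i j * ent (S :\ j) k (n2 j)))) => [|j jS]; last first.
      by rewrite /weighted_ent ent_swp//; ring.
    rewrite big_split/= -!mulr_sumr P_1// mulr1 mulrDr.
    congr (_ + _); first by ring.
    rewrite mulrCA; congr (_ * _); rewrite mulr_sumr.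
    by apply: eq_bigr => j _; rewrite mulrA.
  rewrite big_split/= -!mulr_sumr; congr (_ + _ * _).
  rewrite exchange_big/=; apply: eq_bigr => j jS.
  by rewrite -mulr_suml P_q2.
ring.
Qed.

(** Turns a pointwise estimate into a mean over [i], [j] and the rest, the shape in which the
    induction hypothesis applies: [A] is the cost of the step, [F] that of the rest. *)
Lemma glue_avg_le (A : T -> T -> R) (F : T -> T -> {set T} -> R) (C : {set T} -> R) :
  (forall x, x \in ksub S k.+1 -> C x <=
     k.+1%:R^-1 * \sum_(i in x) \sum_(j in S) P i j * (A i j + F i j (x :\ i))) ->
  \sum_(x in ksub S k.+1) nu1 x * C x <=
  \sum_(i in S) q1 i * \sum_(j in S) P i j *
     (A i j + \sum_(x in ksub (S :\ i) k) n1 i x * F i j x).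
Proof.
move=> CF.
apply: (@le_trans _ _ (\sum_(x in ksub S k.+1) nu1 x * (k.+1%:R^-1 *
   \sum_(i in x) \sum_(j in S) P i j * (A i j + F i j (x :\ i))))).
  by apply: ler_sum => x xS; rewrite ler_wpM2l ?nu1_ge0 ?CF.
rewrite (kprob_avg (fun i x => \sum_(j in S) P i j * (A i j + F i j x)) n1E).
rewrite le_eqVlt; apply/orP; left; apply/eqP; apply: eq_bigr => i iS.
congr (_ * _); under eq_bigr do rewrite mulr_sumr.
rewrite exchange_big/=; apply: eq_bigr => j jS.
rewrite -[in RHS](mul1r (A i j)) -(n1_kprob iS).2 mulr_suml -big_split/= mulr_sumr.
by apply: eq_bigr => x _; ring.
Qed.

Lemma glue_loss2_le :
  \sum_(x in ksub S k.+1) nu1 x * \sum_(l in x) loss S k.+1 p x l ^+ 2 <=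
  2 * weighted_ent S k.+1 nu1 nu2.
Proof.
apply: le_trans (@glue_avg_le (fun i _ => (1 - P i i) ^+ 2)
   (fun i j x => \sum_(l in x) loss (S :\ i) k (K i j) x l ^+ 2) _ _) _.
  move=> x xS; apply: le_trans (glue_loss2 P_ge0 P_1 K_kprob xS) _.
  rewrite ler_wpM2l ?invr_ge0//; apply: ler_sum => i ix.
  have iS := ksub_subset xS ix.
  under [leRHS]eq_bigr do rewrite mulrDr.
  by rewrite big_split/= -mulr_suml P_1// mul1r.
rewrite weighted_ent_chain mulrDr.
apply: (@le_trans _ _ (\sum_(i in S) q1 i * (1 - P i i) ^+ 2 +
   \sum_(i in S) q1 i * \sum_(j in S) P i j * (2 * E i j))).
  rewrite -big_split/=; apply: ler_sum => i iS.
  rewrite -mulrDr ler_wpM2l ?q1_ge0//.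
  under eq_bigr do rewrite mulrDr.
  rewrite big_split/= -mulr_suml P_1// mul1r lerD2l.
  apply: ler_sum => j jS; rewrite ler_wpM2l ?P_ge0//.
  by have [_ _ _ + _] := K_good iS jS.
rewrite lerD//.
  apply: le_trans (step_loss c1_gt1 c2_gt1 c12 q1_1 q2_ge0 P_diag) _.
  rewrite -mulrA ler_wpM2l// ler_wpM2l ?invr_ge0//.
  apply: ler_sum_pred => [i /andP[]//|i iS].
  by apply: phi2_ge0 => //; rewrite mulr_ge0 ?q1_ge0 ?q2_ge0.
rewrite mulr_sumr le_eqVlt; apply/orP; left; apply/eqP.
apply: eq_bigr => i _; rewrite mulrCA; congr (_ * _); rewrite mulr_sumr.
by apply: eq_bigr => j _; rewrite mulrCA.
Qed.

(** With [t] the cost of the step and [u] that of the rest,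
    [(t + u)^2 <= (k + 1) * (t^2 + u^2 / k)]; [t^2] is bounded by [step_tv], and [u^2] by Jensen's
    inequality and induction. *)
Lemma glue_loss_le :
  (\sum_(x in ksub S k.+1) nu1 x * \sum_(l in x) loss S k.+1 p x l) ^+ 2 <=
  k.+1%:R / 2 * weighted_ent S k.+1 nu1 nu2.
Proof.
pose W i j := \sum_(x in ksub (S :\ i) k) n1 i x *
  \sum_(l in x) loss (S :\ i) k (K i j) x l.
pose t := \sum_(i in S) q1 i * (1 - P i i).
pose u := \sum_(i in S) q1 i * \sum_(j in S) P i j * W i j.
have D0 : 0 <= \sum_(x in ksub S k.+1) nu1 x * \sum_(l in x) loss S k.+1 p x l.
  apply: sumr_ge0 => x xS; rewrite mulr_ge0 ?nu1_ge0//; apply: sumr_ge0 => l lx.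
  by apply: ev_ge0; exact: glue_kprob.
have Dtu : \sum_(x in ksub S k.+1) nu1 x * \sum_(l in x) loss S k.+1 p x l <= t + u.
  apply: le_trans (@glue_avg_le (fun i _ => 1 - P i i)
     (fun i j x => \sum_(l in x) loss (S :\ i) k (K i j) x l) _ _) _.
    move=> x xS; apply: le_trans (glue_loss P_ge0 P_1 K_kprob xS) _.
    rewrite ler_wpM2l ?invr_ge0//; apply: ler_sum => i ix.
    have iS := ksub_subset xS ix.
    under [leRHS]eq_bigr do rewrite mulrDr.
    by rewrite big_split/= -mulr_suml P_1// mul1r.
  rewrite /t /u -big_split/=; apply: ler_sum => i iS.
  under eq_bigr do rewrite mulrDr.
  by rewrite big_split/= -mulr_suml P_1// mul1r mulrDr.
apply: (le_trans (ler_sqrW D0 Dtu)).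
rewrite weighted_ent_chain; set F := \sum_(i in S) q1 i * \sum_(j in S) P i j * E i j.
have := step_tv c1_gt1 c2_gt1 c12 q1_ge0 q1_1 q2_ge0 q2_1 P_diag.
rewrite -/t => tv.
have uF : u ^+ 2 <= k%:R / 2 * F.
  apply: le_trans (jensen_sqr _ q1_ge0 q1_1) _.
  rewrite /F mulr_sumr; apply: ler_sum => i iS.
  rewrite [leRHS]mulrCA ler_wpM2l ?q1_ge0//.
  apply: le_trans (jensen_sqr _ (fun j => @P_ge0 i j iS) (P_1 iS)) _.
  rewrite mulr_sumr; apply: ler_sum => j jS.
  rewrite [leRHS]mulrCA ler_wpM2l ?P_ge0//.
  by have [_ _ + _ _] := K_good iS jS.
(* The quotient [u^2 / k] makes no sense for [k = 0], but then [u = 0]. *)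
have [k0|k0] := posnP k.
  have u0 : u = 0.
    by apply/eqP; rewrite -sqrf_eq0 eq_le sqr_ge0 andbT (le_trans uF)// k0 !mul0r.
  suff F0 : 0 <= F by rewrite u0 k0 addr0; lra.
  apply: sumr_ge0 => i iS; rewrite mulr_ge0 ?q1_ge0//; apply: sumr_ge0 => j jS.
  rewrite mulr_ge0 ?P_ge0//; have [_ _ _ + _] := K_good iS jS.
  move=> H; suff : 0 <= 2 * E i j by lra.
  apply: le_trans H; apply: sumr_ge0 => x xS.
  rewrite mulr_ge0 ?(n1_kprob iS).1//; apply: sumr_ge0 => l _; exact: sqr_ge0.
have kR : 0 < k%:R :> R by rewrite ltr0n.
move: uF kR; rewrite -[k.+1%:R]natr1; move: (k%:R : R) => r uF r0.
rewrite -(@ler_pM2l _ r)//.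
(* This square is [k] times the slack of the Cauchy-Schwarz bound. *)
have := sqr_ge0 (r * t - u); nra.
Qed.

Lemma glue_gain2_le J (a : T -> R) : J \subset S -> (forall l, l \in J -> 0 <= a l) ->
  \sum_(x in ksub S k.+1) nu1 x * (\sum_(l in x) loss S k.+1 p x l ^+ 2 +
     \sum_(l in J | l \notin x) (a l + gain S k.+1 p x l) ^+ 2) <=
  8 * weighted_ent S k.+1 nu1 nu2 + kappa #|S| k.+1 * \sum_(l in J) a l ^+ 2.
Proof.
move=> JS a0.
have SJ j : j \in J -> j \in S by move/(subsetP JS).
apply: le_trans (@glue_avg_le
   (fun i j => (1 - P i i) ^+ 2 +
      (if (j \in J) && (j != i) then (a j + P i j) ^+ 2 else 0))
   (fun i j x => \sum_(l in x) loss (S :\ i) k (K i j) x l ^+ 2 +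
      \sum_(l in J :\ i :\ j | l \notin x)
         (a l + P i l + gain (S :\ i) k (K i j) x l) ^+ 2) _ _) _.
  move=> x xS.
  apply: le_trans (lerD (glue_loss2 P_ge0 P_1 K_kprob xS)
    (glue_gain2 P_ge0 P_1 K_kprob xS JS a0)) _.
  rewrite -mulrDr -big_split/= ler_wpM2l ?invr_ge0//; apply: ler_sum => i ix.
  have iS := ksub_subset xS ix.
  rewrite -[X in X + _ + _]mul1r -(P_1 iS) mulr_suml -!big_split/=.
  apply: ler_sum => j jS; rewrite le_eqVlt; apply/orP; left; apply/eqP.
  by rewrite /loss /gain; ring.
(* From [2 * (k + 1) <= N] follows [2 * k <= N - 1], so [sum_inv_half] applies. *)
have k' : 5 / 4 <= kappa #|S|.-1 k <= 2.
  have : \sum_(l < k) (#|S|.-1 - l)%:R^-1 <= 3 / 4 :> R.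
    by apply: sum_inv_half; lia.
  have : 0 <= \sum_(l < k) (#|S|.-1 - l)%:R^-1 :> R by apply: sumr_ge0 => l _; rewrite invr_ge0.
  by rewrite /kappa; lra.
have kS1 : kappa #|S| k.+1 = kappa #|S|.-1 k + N^-1.
  rewrite /kappa big_ord_recl subn0 addrA addrAC; congr (_ + _ + _).
  apply: eq_bigr => l _; congr (_%:R^-1).
  by rewrite lift0 -subn1 -subnDA add1n.
rewrite weighted_ent_chain mulrDr addrAC kS1.
have := step_gain c1_gt1 c2_gt1 c12 q1_ge0 q1_1 q2_ge0 P_ge0 P_1 P_q2 P_diag JS a0 k'.
move=> SG; apply: le_trans (lerD SG (lexx _)).
rewrite mulr_sumr -big_split/=; apply: ler_sum => i iS.
rewrite [X in _ <= _ + X]mulrCA -mulrDr ler_wpM2l ?q1_ge0//.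
have IH j : j \in S -> \sum_(x in ksub (S :\ i) k) n1 i x *
    (\sum_(l in x) loss (S :\ i) k (K i j) x l ^+ 2 +
     \sum_(l in J :\ i :\ j | l \notin x)
        (a l + P i l + gain (S :\ i) k (K i j) x l) ^+ 2) <=
    8 * E i j + kappa #|S|.-1 k * \sum_(l in J :\ i :\ j) (a l + P i l) ^+ 2.
  move=> jS; have [_ _ _ _ H] := K_good iS jS.
  have -> : #|S|.-1 = #|S :\ i| by rewrite [in LHS](cardsD1 i S) iS add1n.
  apply: H => [|l].
    by apply: subset_trans (subD1set _ _) _; exact: setSD.
  rewrite !inE => /and3P[_ _ lJ].
  by apply: addr_ge0; [exact: a0|apply: P_ge0 => //; exact: SJ].
apply: (@le_trans _ _ (\sum_(j in S) P i j * ((1 - P i i) ^+ 2 +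
   (if (j \in J) && (j != i) then (a j + P i j) ^+ 2 else 0) +
   (8 * E i j + kappa #|S|.-1 k * \sum_(l in J :\ i :\ j) (a l + P i l) ^+ 2)))).
  by apply: ler_sum => j jS; rewrite ler_wpM2l ?P_ge0// lerD2l IH.
rewrite le_eqVlt; apply/orP; left; apply/eqP.
set k0 := kappa _ _; pose b l := (a l + P i l) ^+ 2.
transitivity ((1 - P i i) ^+ 2 + \sum_(j in J | j != i) P i j * b j +
    8 * (\sum_(j in S) P i j * E i j) +
    k0 * \sum_(j in S) P i j * \sum_(l in J :\ i :\ j) b l).
  have E1 : (1 - P i i) ^+ 2 = \sum_(j in S) P i j * (1 - P i i) ^+ 2.
    by rewrite -mulr_suml P_1// mul1r.
  rewrite [X in _ = X + _ + _ + _]E1.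
  have -> : \sum_(j in J | j != i) P i j * b j =
      \sum_(j in S) P i j * (if (j \in J) && (j != i) then b j else 0).
    rewrite [RHS](eq_bigr (fun j => if (j \in J) && (j != i) then P i j * b j else 0)); last first.
      by move=> j _; case: ifP => // _; rewrite mulr0.
    rewrite -big_mkcondr/=; apply: eq_bigl => j.
    by case: (boolP (j \in J)) => [/SJ->//|]; rewrite andbF.
  rewrite 2!mulr_sumr -!big_split/=; apply: eq_bigr => j _; rewrite /b; ring.
(* An index [l] stays in the potential unless [j = l], hence the weight [1 - P i l] found in
   [step_gain]. *)
have -> : \sum_(j in S) P i j * \sum_(l in J :\ i :\ j) b l =
    \sum_(l in J | l != i) b l * (1 - P i l).
  under eq_bigr do rewrite mulr_sumr.
  rewrite (exchange_big_dep (fun l => (l \in J) && (l != i)))/=; last first.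
    by move=> j l _; rewrite !inE => /and3P[_ -> ->].
  apply: eq_bigr => l /andP[lJ li].
  have -> : 1 - P i l = \sum_(j in S | j != l) P i j.
    by rewrite -(P_1 iS) [in LHS](bigD1 l)/= ?SJ// addrC addrK.
  rewrite mulr_sumr; apply: eq_big => [j|j _]; last by rewrite mulrC.
  by rewrite !inE lJ li/= !andbT eq_sym.
rewrite addrAC; congr (_ + _); rewrite -addrA; congr (_ + _).
rewrite mulr_sumr -big_split/=; apply: eq_bigr => j _; rewrite /b; ring.
Qed.

End Step.

Theorem slice_kernel k : forall S nu1 nu2, (k.*2 <= #|S|)%N ->
  kprob S k nu1 -> kprob S k nu2 -> exists p, good_kernel S k nu1 nu2 p.
Proof.
elim: k => [|k IH] S nu1 nu2 kS nu1P nu2P.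
  by exists (fun _ _ => 1); exact: good_kernel0.
have kS' : (k < #|S|)%N by lia.
have [q1 [n1 [q1_ge0 q1_1 n1P n1E]]] := kprob_disintegration kS' nu1P.
have [q2 [n2 [q2_ge0 q2_1 n2P n2E]]] := kprob_disintegration kS' nu2P.
have [P [P_ge0 P_1 P_q2 P_diag]] := maximal_coupling q1_ge0 q1_1 q2_ge0 q2_1.
have /choice [K KP] : forall ij : T * T, exists p, ij.1 \in S -> ij.2 \in S ->
    good_kernel (S :\ ij.1) k (n1 ij.1) (fun x => n2 ij.2 (swp ij.1 ij.2 x)) p.
  move=> [i j]/=; have [iS|] := boolP (i \in S); last by exists (fun _ _ => 0).
  have [jS|] := boolP (j \in S); last by exists (fun _ _ => 0).
  have [|p pP] := IH (S :\ i) (n1 i) (fun x => n2 j (swp i j x)) _ (n1P i iS) (kprob_swp iS jS (n2P j jS)).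
    by move: kS; rewrite (cardsD1 i S) iS; lia.
  by exists p.
have KG i j : i \in S -> j \in S -> good_kernel (S :\ i) k (n1 i)
    (fun x => n2 j (swp i j x)) (K (i, j)) by exact: (KP (i, j)).
have K_kprob i j x : i \in S -> j \in S -> x \in ksub (S :\ i) k ->
    kprob (S :\ i) k (K (i, j) x).
  by move=> iS jS; have [+ _ _ _ _] := KG i j iS jS; apply.
have nu1_ge0 := nu1P.1.
exists (glue S k P (fun i j => K (i, j))); split.
- by move=> x; exact: (glue_kprob P_ge0 P_1 K_kprob).
- by move=> y; exact: (glue_marginal n1E n2E P_q2 KG).
- exact: (glue_loss_le nu1_ge0 q1_ge0 q1_1 q2_ge0 q2_1
    n1P n2P n1E n2E P_ge0 P_1 P_q2 P_diag KG).
- exact: (glue_loss2_le nu1_ge0 q1_ge0 q1_1 q2_ge0 q2_1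
    n1P n2P n1E n2E P_ge0 P_1 P_q2 P_diag KG).
move=> J a; exact: (glue_gain2_le kS nu1_ge0 q1_ge0 q1_1 q2_ge0 q2_1
    n1P n2P n1E n2E P_ge0 P_1 P_q2 P_diag KG).
Qed.

End Main.

(** * Cauchy-Schwarz and the optimal weights *)

Lemma sqr_sum_le_card (R : realFieldType) (T : finType) (A : {set T}) (f : T -> R) :
  (\sum_(i in A) f i) ^+ 2 <= #|A|%:R * \sum_(i in A) f i ^+ 2.
Proof.
have [A0|A0] := posnP #|A|.
  by rewrite A0 mul0r (cards0_eq A0) big_set0 expr0n.
have A0' : 0 < #|A|%:R :> R by rewrite ltr0n.
have w1 : \sum_(i in A) #|A|%:R^-1 = 1 :> R.
  by rewrite sumr_const -[LHS]mulr_natr mulVf// gt_eqF.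
have := jensen_sqr f (fun i _ => ltW _) w1; rewrite -!mulr_sumr exprMn => H.
rewrite -(@ler_pM2l _ (#|A|%:R^-1 ^+ 2)) ?exprn_gt0 ?invr_gt0//.
apply: le_trans (H _) _ => [_|]; first by rewrite invr_gt0.
by rewrite expr2 -mulrA mulKf// gt_eqF.
Qed.

Section Optimize.
Variable R : realType.
Implicit Types (h u v : R).

Lemma le_sqr_sum_sqrt (X : \bar R) h1 h2 : 0 <= h1 -> 0 <= h2 ->
  (forall c1 c2 : R, 1 < c1 -> 1 < c2 -> (c1 - 1) * (c2 - 1) = 1 ->
    (X <= (c1 * h1 + c2 * h2)%:E)%E) ->
  (X <= (sqrte h1%:E + sqrte h2%:E) ^+ 2)%E.
Proof.
move=> h1_ge0 h2_ge0 H; rewrite /sqrte -EFinD -EFin_expe.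
have [u0 v0] := (sqrtr_ge0 h1, sqrtr_ge0 h2).
rewrite -(sqr_sqrtr h1_ge0) -(sqr_sqrtr h2_ge0) in H.
set u := Num.sqrt h1 in u0 H *; set v := Num.sqrt h2 in v0 H *.
(* The optimal weights [(u + v) / u] and [(u + v) / v] break down when [u] or [v] is 0; shifting
   both by [d] keeps the constraint and costs at most [2 * d * (u + v) <= e]. *)
apply/lee_addgt0Pr => e e0; pose d := e / (2 * (u + v) + 1).
have D0 : 0 < 2 * (u + v) + 1 by lra.
have d0 : 0 < d by rewrite divr_gt0.
have [ud vd] : u + d != 0 /\ v + d != 0 by split; rewrite gt_eqF//; lra.
apply: le_trans (H ((u + v + 2 * d) / (u + d)) ((u + v + 2 * d) / (v + d)) _ _ _) _.
- by rewrite ltr_pdivlMr; lra.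
- by rewrite ltr_pdivlMr; lra.
- by field; rewrite ud vd.
rewrite -EFinD lee_fin.
have de : 2 * d * (u + v) <= e.
  have -> : e = d * (2 * (u + v) + 1) by rewrite divfK// gt_eqF.
  nra.
have b (w : R) : 0 <= w -> (u + v + 2 * d) / (w + d) * w ^+ 2 <= (u + v + 2 * d) * w.
  move=> w0; rewrite -mulrA ler_wpM2l//; first lra.
  by rewrite mulrC ler_pdivrMr; nra.
have := b _ u0; have := b _ v0; nra.
Qed.

End Optimize.

(** * From subsets of fixed size to the slice *)

Section Transfer.
Variables (R : realType) (n k : nat) (b : bool).
Hypothesis kn : (k <= n)%N.
Local Notation X := (slice n k).
Implicit Types (x y : X) (nu : X -> R).

(* With [b = false] a point of the slice is represented by its zeros, which
   exchanges the roles of [k] and [n - k]. *)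
Definition support x : {set 'I_n} := [set i | val x i == b].

Definition level := if b then k else (n - k)%N.

Lemma card_bit (f : {ffun 'I_n -> bool}) :
  #|[set i | f i == b]| = if b then (\sum_(i < n) f i)%N else (n - \sum_(i < n) f i)%N.
Proof.
have e : (\sum_(i < n) f i)%N = #|[set i | f i]|.
  rewrite -sum1_card [RHS]big_mkcond/=; apply: eq_bigr => i _.
  by rewrite inE; case: (f i).
case: b; first by rewrite e; apply: eq_card => i; rewrite !inE eqb_id.
rewrite e cardsCs card_ord; congr (_ - _)%N.
by apply: eq_card => i; rewrite !inE; case: (f i).
Qed.

Lemma support_inj : injective support.
Proof.
move=> x y /setP e; apply/val_inj/ffunP => i.
by have := e i; rewrite !inE; case: b; case: (val x i); case: (val y i).
Qed.

Lemma imset_support : support @: [set: X] = ksub [set: 'I_n] level.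
Proof.
apply/setP=> A; rewrite inE subsetT/=; apply/imsetP/eqP => [[x _ ->]|cA].
  by rewrite card_bit (eqP (valP x)).
pose f := [ffun i => (i \in A) == b].
have fA : [set i | f i == b] = A.
  by apply/setP=> i; rewrite inE ffunE; case: b; case: (i \in A).
have fk : (\sum_(i < n) f i == k)%N.
  have : (\sum_(i < n) f i <= n)%N.
    rewrite -[leqRHS]card_ord -sum1_card; apply: leq_sum => i _; exact: leq_b1.
  have := card_bit f; rewrite fA cA /level; move: (\sum_(i < n) f i)%N => m.
  by move: kn; case: b => [_ <-|kn' mk mn]//; apply/eqP; lia.
by exists (exist _ f fk : X); [rewrite inE | rewrite -[LHS]fA].
Qed.

Lemma sum_support (F : {set 'I_n} -> R) :
  \sum_(A in ksub [set: 'I_n] level) F A = \sum_x F (support x).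
Proof.
rewrite -imset_support big_imset/=; last by move=> x y _ _; exact: support_inj.
by apply: eq_bigl => x; rewrite inE.
Qed.

Lemma support_ksub x : support x \in ksub [set: 'I_n] level.
Proof. by rewrite -imset_support imset_f. Qed.

Definition push nu (A : {set 'I_n}) : R := \sum_x nu x * (support x == A)%:R.

Lemma push_support nu x : push nu (support x) = nu x.
Proof.
rewrite /push (bigD1 x)//= eqxx mulr1 big1 ?addr0// => y yx.
by rewrite (inj_eq support_inj) (negPf yx) mulr0.
Qed.

Lemma push_kprob nu : is_prob nu -> kprob [set: 'I_n] level (push nu).
Proof.
move=> [nu0 nu1]; split=> [A _|].
  by apply: sumr_ge0 => x _; rewrite mulr_ge0.
by rewrite sum_support -nu1; apply: eq_bigr => x _; rewrite push_support.
Qed.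

Lemma card_slice : #|{: X}| = 'C(n, level).
Proof.
have := cards_draws [set: 'I_n] level.
rewrite cardsT card_ord => <-; rewrite -/(ksub _ _) -imset_support.
by rewrite card_imset ?cardsT//; exact: support_inj.
Qed.

Lemma rel_entropy_push nu : is_prob nu ->
  rel_entropy nu (@unif R X) = (ent [set: 'I_n] level (push nu))%:E.
Proof.
move=> [nu0 nu1]; have X0 : #|{: X}|%:R != 0 :> R.
  by rewrite card_slice pnatr_eq0 -lt0n bin_gt0 /level; case: b; rewrite ?leq_subr.
(* As [k <= n] the slice is nonempty, so the uniform law has no null point and domination is
   automatic. *)
rewrite /rel_entropy asboolT => [|x /eqP]; last by rewrite /unif invr_eq0 (negPf X0).
congr EFin; rewrite /ent sum_support; apply: eq_bigr => x _.
by rewrite push_support /unif invrK mulrC cardsT card_ord card_slice.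
Qed.

Lemma rel_entropy_push_ge0 nu : is_prob nu -> 0 <= ent [set: 'I_n] level (push nu).
Proof.
move=> [nu0 nu1]; rewrite /ent sum_support.
have nuT : \sum_(x in [set: X]) nu x = 1.
  by rewrite -nu1; apply: eq_bigl => x; rewrite inE.
have := sum_phi nuT; rewrite cardsT (eq_bigl xpredT) => [e|x]; last by rewrite inE.
rewrite [leRHS](_ : _ = #|{: X}|%:R^-1 * \sum_x phi (#|{: X}|%:R * nu x)).
  rewrite mulr_ge0 ?invr_ge0//; apply: sumr_ge0 => x _; apply: phi_ge0.
  exact: mulr_ge0.
rewrite e; apply: eq_big => [x|x _]; first by rewrite inE.
by rewrite push_support cardsT card_ord card_slice.
Qed.

(** Both supports have the same size, so as many elements are gained as lost, which cancels the
    factor 1/2. *)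
Lemma hamming_support x y :
  hamming R x y = \sum_(i in support x) (i \notin support y)%:R.
Proof.
have cx : #|support x| = #|support y|.
  have := support_ksub x; have := support_ksub y.
  by rewrite !inE => /andP[_ /eqP->] /andP[_ /eqP->].
have card1 (A : {set 'I_n}) : \sum_i (i \in A)%:R = #|A|%:R :> R.
  by rewrite -sum1_card natr_sum [RHS]big_mkcond/=; apply: eq_bigr => i _; case: ifP.
have e : \sum_i ((i \in support x)%:R - (i \in support y)%:R) = 0 :> R.
  by rewrite sumrB !card1 cx subrr.
have E : \sum_(i < n) differ R x y i =
    2 * \sum_(i in support x) (i \notin support y)%:R.
  rewrite -[LHS]addr0 -[X in _ + X]e -big_split/= mulr_sumr [RHS]big_mkcond/=.
  apply: eq_bigr => i _; rewrite /differ !inE.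
  by case: b; case: (val x i); case: (val y i) => /=; ring.
by rewrite /hamming E mulrA mulVf ?mul1r.
Qed.

Lemma differ_support x y i : differ R x y i =
  if i \in support x then (i \notin support y)%:R else (i \in support y)%:R.
Proof. by rewrite /differ !inE; case: b; case: (val x i); case: (val y i). Qed.

Section Kernel.
Variables (c1 c2 : R).
Hypotheses (c1_gt1 : 1 < c1) (c2_gt1 : 1 < c2) (c12 : (c1 - 1) * (c2 - 1) = 1).
Variables (nu1 nu2 : X -> R).
Hypotheses (nu1P : is_prob nu1) (nu2P : is_prob nu2).
Hypothesis level2 : (level.*2 <= n)%N.

Local Notation S := [set: 'I_n].
Local Notation E := (weighted_ent c1 c2 S level (push nu1) (push nu2)).

Lemma transport_kernel : exists pi p,
  [/\ coupling nu1 nu2 pi, disintegration nu1 pi p,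
      (\sum_xy hamming R xy.1 xy.2 * pi xy) ^+ 2 <= level%:R / 2 * E,
      \sum_x (\sum_y hamming R x y * p x y) ^+ 2 * nu1 x <= 2 * level%:R * E
    & \sum_x (\sum_(i < n) (\sum_y differ R x y i * p x y) ^+ 2) * nu1 x <= 8 * E].
Proof.
have [|p [pP pE p1 p2 p3]] := slice_kernel c1_gt1 c2_gt1 c12 _ (push_kprob nu1P) (push_kprob nu2P).
  by rewrite cardsT card_ord.
have [[nu1_ge0 nu1_1] [nu2_ge0 nu2_1]] := (nu1P, nu2P).
pose q x y := p (support x) (support y).
have qP x : is_prob (q x).
  have [p0 p_1] := pP _ (support_ksub x).
  by split=> [y|]; [exact: p0 (support_ksub y)|rewrite -p_1 sum_support].
have qE y : \sum_x nu1 x * q x y = nu2 y.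
  rewrite -(push_support nu2) -(pE _ (support_ksub y)) sum_support.
  by apply: eq_bigr => x _; rewrite push_support.
have evE (Q : pred {set 'I_n}) x :
    ev S level (p (support x)) Q = \sum_y (Q (support y))%:R * q x y.
  by rewrite /ev sum_support; apply: eq_bigr => y _; rewrite mulrC.
have hamE x : \sum_y hamming R x y * q x y =
    \sum_(i in support x) loss S level p (support x) i.
  rewrite (eq_bigr (fun y => \sum_(i in support x) (i \notin support y)%:R * q x y)).
    by rewrite exchange_big/=; apply: eq_bigr => i _; rewrite /loss evE.
  by move=> y _; rewrite hamming_support mulr_suml.
have sumE (F : {set 'I_n} -> R) : \sum_(A in ksub S level) push nu1 A * F A =
    \sum_x F (support x) * nu1 x.
  by rewrite sum_support; apply: eq_bigr => x _; rewrite push_support mulrC.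
exists (fun xy => nu1 xy.1 * q xy.1 xy.2), q; split.
- have m1 x : \sum_y nu1 x * q x y = nu1 x by rewrite -mulr_sumr (qP x).2 mulr1.
  split=> //; split=> [[x y]|]; first by rewrite mulr_ge0// (qP x).1.
  rewrite -(pair_big xpredT xpredT (fun x y => nu1 x * q x y))/= -nu1_1.
  by apply: eq_bigr => x _.
- by split.
- rewrite -(pair_big xpredT xpredT (fun x y => hamming R x y * (nu1 x * q x y)))/=.
  rewrite sumE in p1; apply: le_trans p1; rewrite le_eqVlt; apply/orP; left; apply/eqP.
  congr (_ ^+ 2); apply: eq_bigr => x _; rewrite -hamE mulr_suml.
  by apply: eq_bigr => y _; rewrite mulrCA mulrC.
(* Cauchy-Schwarz over the elements of the support yields the factor [level]. *)
- rewrite sumE in p2; rewrite [2 * _]mulrC -mulrA.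
  apply: le_trans (ler_wpM2l (ler0n _ level) p2); rewrite mulr_sumr.
  apply: ler_sum => x _; rewrite mulrA ler_wpM2r// hamE.
  have cx : #|support x| = level by have := support_ksub x; rewrite inE => /andP[_ /eqP].
  by have := sqr_sum_le_card (support x) (loss S level p (support x)); rewrite cx.
(* With zero offsets and [J] full, losses and gains together run over all coordinates. *)
- have := p3 setT (fun=> 0) (subxx _) (fun _ _ => lexx _).
  rewrite [\sum_(l in _) 0 ^+ 2]big1 ?mulr0 ?addr0 => [|i _]; last by rewrite expr0n.
  rewrite sumE; apply: le_trans; rewrite le_eqVlt; apply/orP; left; apply/eqP.
  apply: eq_bigr => x _; congr (_ * _).
  rewrite (bigID (fun i => i \in support x))/=; congr (_ + _).
    apply: eq_bigr => i ix; rewrite /loss evE; congr (_ ^+ 2).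
    by apply: eq_bigr => y _; rewrite differ_support ix.
  apply: eq_big => [i|i ix]; first by rewrite in_setT.
  rewrite /gain evE add0r; congr (_ ^+ 2).
  by apply: eq_bigr => y _; rewrite differ_support (negPf ix).
Qed.

End Kernel.

End Transfer.

(** * One kernel bounds the three infima *)

Theorem theorem1p4 (R : realType) (n k : nat) (hn : (1 <= n)%N)
    (hk : (k <= n)%N) :
  let mu : slice n k -> R := @unif R (slice n k) in
  let C : R := (slice_const n k)%:R in
  (forall nu1 nu2 : slice n k -> R, is_prob nu1 -> is_prob nu2 ->
     ((2 / C)%:E * W1 nu1 nu2 ^+ 2
        <= (sqrte (rel_entropy nu1 mu) + sqrte (rel_entropy nu2 mu)) ^+ 2)%E
     /\
     ((1 / (2 * C))%:E * T2tilde nu2 nu1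
        <= (sqrte (rel_entropy nu1 mu) + sqrte (rel_entropy nu2 mu)) ^+ 2)%E)
  /\
  (forall nu1 nu2 : slice n k -> R, is_prob nu1 -> is_prob nu2 ->
     ((1 / 8)%:E * T2hat nu2 nu1
        <= (sqrte (rel_entropy nu1 mu) + sqrte (rel_entropy nu2 mu)) ^+ 2)%E).
Proof.
move=> mu C.
(* Points are encoded by their ones or their zeros, whichever makes the level equal to
   [min(k, n - k)]. *)
pose b := (k <= n - k)%N.
have lvl : level n k b = slice_const n k.
  by rewrite /level /slice_const /b; case: leqP => [/minn_idPl|/ltnW/minn_idPr].
have lvl2 : ((level n k b).*2 <= n)%N by rewrite lvl /slice_const; lia.
have CE : C = (level n k b)%:R by rewrite lvl.
have C0 : 0 <= C by exact: ler0n.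
split=> nu1 nu2 nu1P nu2P;
  rewrite (rel_entropy_push b hk nu1P) (rel_entropy_push b hk nu2P);
  have h1 := rel_entropy_push_ge0 b hk nu1P;
  have h2 := rel_entropy_push_ge0 b hk nu2P.
- split; apply: le_sqr_sum_sqrt => // c1 c2 c1_gt1 c2_gt1 c12;
    have [pi [p [cp ds w1 t2 _]]] := transport_kernel hk c1_gt1 c2_gt1 c12 nu1P nu2P lvl2;
    rewrite -CE in w1 t2;
    have E0 : 0 <= c1 * ent [set: 'I_n] (level n k b) (push b nu1) +
                   c2 * ent [set: 'I_n] (level n k b) (push b nu2)
      by apply: addr_ge0; apply: mulr_ge0 => //; lra.
  + have W0 : (0 <= W1 nu1 nu2)%E.
      apply: le_ereal_inf_tmp => _ [pi' [[[pi0 _] _ _] ->]]; rewrite lee_fin.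
      apply: sumr_ge0 => xy _; apply: mulr_ge0 => //.
      by apply: mulr_ge0; rewrite ?invr_ge0//; apply: sumr_ge0 => i _; exact: ler0n.
    have WD : (W1 nu1 nu2 <= (\sum_xy hamming R xy.1 xy.2 * pi xy)%:E)%E.
      by apply: ereal_inf_lbound; exists pi.
    apply: (@le_trans _ _ ((2 / C)%:E * (\sum_xy hamming R xy.1 xy.2 * pi xy)%:E ^+ 2)%E).
      apply: lee_wpmul2l; first by rewrite lee_fin divr_ge0.
      by rewrite lee_sqr// (le_trans W0).
    rewrite -EFin_expe -EFinM lee_fin.
    (* For [C = 0] the convention [0^-1 = 0] makes the left-hand side 0. *)
    move: C0; rewrite le_eqVlt => /predU1P[<-|C0]; first by rewrite invr0 mulr0 mul0r.
    by rewrite mulrAC ler_pdivrMr//; rewrite /weighted_ent in w1; lra.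
  + have TD : (T2tilde nu2 nu1 <=
        (\sum_x (\sum_y hamming R x y * p x y) ^+ 2 * nu1 x)%:E)%E.
      by apply: ereal_inf_lbound; exists pi, p.
    apply: (@le_trans _ _ ((1 / (2 * C))%:E *
        (\sum_x (\sum_y hamming R x y * p x y) ^+ 2 * nu1 x)%:E)%E).
      by apply: lee_wpmul2l => //; rewrite lee_fin divr_ge0// mulr_ge0.
    rewrite -EFinM lee_fin.
    move: C0; rewrite le_eqVlt => /predU1P[<-|C0].
      by rewrite mulr0 invr0 mulr0 mul0r.
    by rewrite mul1r mulrC ler_pdivrMr ?mulr_gt0//; rewrite /weighted_ent in t2; lra.
- apply: le_sqr_sum_sqrt => // c1 c2 c1_gt1 c2_gt1 c12.
  have [pi [p [cp ds _ _ th]]] := transport_kernel hk c1_gt1 c2_gt1 c12 nu1P nu2P lvl2.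
  have TD : (T2hat nu2 nu1 <=
      (\sum_x (\sum_(i < n) (\sum_y differ R x y i * p x y) ^+ 2) * nu1 x)%:E)%E.
    by apply: ereal_inf_lbound; exists pi, p.
  apply: (le_trans (lee_wpmul2l _ TD)); first by rewrite lee_fin; lra.
  by rewrite -EFinM lee_fin; rewrite /weighted_ent in th; lra.
Qed.
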